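(* For $n\geq1$, $$A_n^{(l)}(t,r,q)=\sum_{\pi\in C_l\wr\mathfrak{S}_n} t^{\mathrm{flec}(\pi)}r^{\mathrm{pix}(\pi)}q^{\mathrm{inv}(\pi)-\mathrm{lec}(\pi)}.$$
   Context: $C_l\wr\mathfrak{S}_n$ is the set of words $\pi=\pi_1\cdots\pi_n$ with $\pi_i=|\pi_i|^{\epsilon_i}$, $\epsilon_i\in\{0,\dots,l-1\}$, $|\pi|=|\pi_1|\cdots|\pi_n|\in\mathfrak{S}_n$. Order colored integers by $u^a<v^b$ iff $a>b$, or $a=b$ and $u<v$; $\mathrm{maj}(\pi)=\sum\{i\in[n-1]:\pi_i>\pi_{i+1}\}$; $\mathrm{exc}(\pi)$ is the number of $i$ with $\epsilon_i=0$ and $|\pi_i|>i$; $\mathrm{fexc}(\pi)=l\,\mathrm{exc}(\pi)+\sum_i\epsilon_i$; $\mathrm{fix}(\pi)=|\{i:\pi_i=i^0\}|$; $A_n^{(l)}(t,r,q)=\sum_{\pi}t^{\mathrm{fexc}(\pi)}r^{\mathrm{fix}(\pi)}q^{(\mathrm{maj}-\mathrm{exc})\pi}$. A word $w_1\cdots w_m$ over positive integers is a hook if $w_1>w_2$ and either $m=2$ or $w_2<w_3<\cdots<w_m$. A word $w=w_1\cdots w_m$ of colored integers is a colored hook if either ($m\ge2$, $|w|$ is a hook, and only $w_1$ may have positive color) or ($m\ge1$, $|w|$ is increasing, and $w_1$ has positive color while all other letters have color $0$). Each $\pi$ has a unique colored hook factorization $\pi=p\,\tau_1\tau_2\cdots\tau_r$,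 where $p$ consists of $0$-colored letters with $|p|$ increasing and each $\tau_i$ is a colored hook. For a word $w$ over integers, $\mathrm{inv}(w)=|\{(i,j):i<j,\ w_i>w_j\}|$. Set $\mathrm{inv}(\pi)=\mathrm{inv}(|\pi|)$, $\mathrm{lec}(\pi)=\sum_{i=1}^r\mathrm{inv}(|\tau_i|)$, $\mathrm{flec}(\pi)=l\cdot\mathrm{lec}(\pi)+\sum_{i=1}^n\epsilon_i$, $\mathrm{pix}(\pi)=\mathrm{length}(p)$. *)

(* Defs.v *)
From HB Require Import structures.
From mathcomp Require Import all_boot all_order all_algebra perm.
Set Implicit Arguments. Unset Strict Implicit. Unset Printing Implicit Defensive.
Import Order.TTheory GRing.Theory Num.Theory.

(* A colored integer u^a is represented by the pair (u, a) : nat * nat. *)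
Definition cint := (nat * nat)%type.
Definition cabs (x : cint) : nat := x.1.
Definition ccol (x : cint) : nat := x.2.

Definition clt (x y : cint) : bool :=
  (ccol y < ccol x) || ((ccol x == ccol y) && (cabs x < cabs y)).

Definition cnth (w : seq cint) (i : nat) : cint := nth (0, 0) w i.

(* The word pi_1 ... pi_n of the colored permutation (s, e):
   pi_i = (s(i-1)+1)^{e(i-1)}  (positions 0-indexed internally). *)
Definition cword (n l : nat) (s : 'S_n) (e : {ffun 'I_n -> 'I_l}) : seq cint :=
  [seq ((s i).+1, nat_of_ord (e i)) | i <- enum 'I_n].

Definition cmaj (w : seq cint) : nat :=
  \sum_(0 <= i < (size w).-1 | clt (cnth w i.+1) (cnth w i)) i.+1.

Definition cexc (w : seq cint) : nat :=
  count (fun i => (ccol (cnth w i) == 0) && (i.+1 < cabs (cnth w i)))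
        (iota 0 (size w)).

Definition csumcol (w : seq cint) : nat := sumn (map ccol w).

Definition cfexc (l : nat) (w : seq cint) : nat := l * cexc w + csumcol w.

Definition cfix (w : seq cint) : nat :=
  count (fun i => cnth w i == (i.+1, 0)) (iota 0 (size w)).

Definition invw (u : seq nat) : nat :=
  \sum_(0 <= i < size u) \sum_(i.+1 <= j < size u) (nth 0 u j < nth 0 u i).

Definition cabsw (w : seq cint) : seq nat := map cabs w.

Definition hook (u : seq nat) : bool :=
  [&& 1 < size u, nth 0 u 1 < nth 0 u 0 & sorted ltn (behead u)].

Definition colored_hook (w : seq cint) : bool :=
  (hook (cabsw w) && all (fun x => ccol x == 0) (behead w))
  || [&& 0 < size w, sorted ltn (cabsw w), 0 < ccol (cnth w 0)
       & all (fun x => ccol x == 0) (behead w)].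

(* Factorization of w determined by the increasing list st of starting
   positions (0-indexed) of tau_1, ..., tau_r:  p = w[0, st_1),
   tau_i = w[st_i, st_{i+1}) with st_{r+1} = size w. *)
Definition fact_p (w : seq cint) (st : seq nat) : seq cint :=
  take (head (size w) st) w.
Definition fact_taus (w : seq cint) (st : seq nat) : seq (seq cint) :=
  map (fun ab : nat * nat => drop ab.1 (take ab.2 w))
      (zip st (rcons (behead st) (size w))).

Definition is_chf (w : seq cint) (st : seq nat) : bool :=
  [&& all (fun x => ccol x == 0) (fact_p w st), sorted ltn (cabsw (fact_p w st))
    & all colored_hook (fact_taus w st)].

Definition starts n (S : {set 'I_n}) : seq nat := [seq val i | i <- enum S].

(* The (unique) colored hook factorization (p, [tau_1; ...; tau_r]) of a word
   w of length n; (w, [::]) is an irrelevant default. *)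
Definition chf (n : nat) (w : seq cint) : seq cint * seq (seq cint) :=
  match [pick X : {set 'I_n} | is_chf w (starts X)] with
  | Some X => (fact_p w (starts X), fact_taus w (starts X))
  | None => (w, [::])
  end.

Definition clec (n : nat) (w : seq cint) : nat :=
  sumn [seq invw (cabsw tau) | tau <- (chf n w).2].
Definition cflec (n l : nat) (w : seq cint) : nat := l * clec n w + csumcol w.
Definition cpix (n : nat) (w : seq cint) : nat := size (chf n w).1.
Definition cinv (w : seq cint) : nat := invw (cabsw w).

(* Main.v *)
(* Both sides satisfy the same recurrence.  Put T = t^l, u = 1 + t + ... + t^(l-1),
   h_m = u (1 + T + ... + T^(m-1)) - 1, and P_m = 1 / ((1-q) ... (1-q^m)); both
   sides, multiplied by P_n, are solutions Q_n of
     Q_n = r^n P_n + sum_(1 <= m <= n) h_m P_m Q_(n-m).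
   On the hook side this is the removal of the last hook: h_m is the weight of the
   colored hooks on m given letters, and the inversions between the last hook and
   the rest contribute a q-binomial coefficient.
   On the Eulerian side, maj - exc is the sum of the descents of the word of keys
   (type, absolute value), where excedances have the smallest type and the other
   letters are typed by decreasing color.  Multiplying by P_n introduces a weakly
   increasing sequence d that increases strictly at these descents; recording at
   the letter pi_i the pair (d_i, type) turns (pi, d) into a word v over pairs.
   Such a v arises iff each v_j satisfies a condition involving only v_j, d_j and
   whether j starts a block of d, so that the words of content a are counted by a
   coefficient of a product over blocks, and the recurrence, multiplied by 1 - T,
   follows from a telescoping of such products, as in the MacMahon master theorem.
   To make P_n finite one works modulo q^N, with t and q indeterminate, and
   specializes at the end. *)
Require Import Defs.
From HB Require Import structures.
From mathcomp Require Import all_boot all_order all_algebra perm.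
From mathcomp Require Import qpoly ring zify.
From mathcomp Require Import mpoly.
Import Order.TTheory GRing.Theory Num.Theory.
Local Open Scope ring_scope.
Set Implicit Arguments.
Unset Strict Implicit.
Unset Printing Implicit Defensive.

(** * Sums over words of a given length *)

Fixpoint wsum (L : finType) (V : nmodType) k (f : seq L -> V) : V :=
  if k is k'.+1 then \sum_x wsum k' (fun w => f (x :: w)) else f [::].

Section WordSum.
Variables (L : finType) (V : nmodType).
Implicit Types f g : seq L -> V.

Lemma eq_wsum k f g :
  (forall w, size w = k -> f w = g w) -> wsum k f = wsum k g.
Proof.
elim: k f g => [|k IH] f g E /=; first exact: E.
by apply: eq_bigr => x _; apply: IH => w Hw; apply: E; rewrite /= Hw.
Qed.

Lemma wsum_cat i j f :
  wsum (i + j) f = wsum i (fun u => wsum j (fun v => f (u ++ v))).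
Proof.
elim: i f => [|i IH] f //=.
by apply: eq_bigr => x _; rewrite IH.
Qed.

Lemma wsum_sum I (s : seq I) (P : pred I) k (F : I -> seq L -> V) :
  wsum k (fun w => \sum_(i <- s | P i) F i w) =
  \sum_(i <- s | P i) wsum k (F i).
Proof.
elim: k F => [|k IH] F //=.
by rewrite exchange_big /=; apply: eq_bigr => x _; rewrite IH.
Qed.

Lemma wsumD k f g :
  wsum k (fun w => f w + g w) = wsum k f + wsum k g.
Proof.
elim: k f g => [|k IH] f g //=.
by rewrite -big_split; apply: eq_bigr => x _; rewrite IH.
Qed.

Lemma wsum0 k : wsum k (fun _ : seq L => 0 : V) = 0.
Proof. by elim: k => //= k IH; rewrite big1. Qed.

(** Passing to a sum over a finite type makes reindexing by bijections available. *)
Lemma wsum_tuple k f : \sum_(w : k.-tuple L) f w = wsum k f.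
Proof.
elim: k f => [|k IH] f /=.
  rewrite (big_pred1 [tuple]) // => w /=.
  by rewrite tuple0; apply/esym/eqP.
under [RHS]eq_bigr => x _ do rewrite -(IH (fun w => f (x :: w))).
rewrite pair_big /= (reindex (fun p : L * k.-tuple L => [tuple of p.1 :: p.2])) //=.
exists (fun w : k.+1.-tuple L => (thead w, [tuple of behead w])).
  by move=> [x w] _ /=; congr pair; apply: val_inj.
by move=> w _ /=; rewrite [RHS]tuple_eta; apply: val_inj.
Qed.

Lemma wsum_ffun n f :
  \sum_(v : {ffun 'I_n -> L}) f [seq v i | i <- enum 'I_n] = wsum n f.
Proof.
rewrite -wsum_tuple.
rewrite (reindex (fun w : n.-tuple L => [ffun i => tnth w i])) /=.
  apply: eq_bigr => w _; congr f.
  by under eq_map => i do rewrite ffunE; rewrite map_tnth_enum.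
exists (fun v : {ffun 'I_n -> L} => [tuple v i | i < n]) => [w _|v _].
  by apply: eq_from_tnth => i; rewrite tnth_mktuple ffunE.
by apply/ffunP => i; rewrite ffunE tnth_mktuple.
Qed.

End WordSum.

Section WordSumRing.
Variables (L : finType) (S : comNzRingType).
Implicit Types f g : seq L -> S.

Lemma wsumMl k c f : wsum k (fun w => c * f w) = c * wsum k f.
Proof.
by elim: k f => //= k IH f; rewrite big_distrr; apply: eq_bigr => x _.
Qed.

Lemma wsumMr k c f : wsum k (fun w => f w * c) = wsum k f * c.
Proof. by rewrite mulrC -wsumMl; apply: eq_wsum => w _; rewrite mulrC. Qed.

End WordSumRing.

Lemma wsum_additive (L : finType) (V W : nmodType) (h : {additive V -> W}) k
    (f : seq L -> V) : h (wsum k f) = wsum k (h \o f).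
Proof.
by elim: k f => //= k IH f; rewrite raddf_sum; apply: eq_bigr => x _; rewrite IH.
Qed.

Lemma wsum_pred1 (L : finType) (V : nmodType) (w0 : seq L) (f : seq L -> V) :
  wsum (size w0) (fun w => if w == w0 then f w else 0) = f w0.
Proof.
elim: w0 f => [|x w0 IH] f //=.
rewrite (bigD1 x) //= big1 ?addr0 => [|y /negPf ne_yx].
  rewrite -[RHS](IH (fun w => f (x :: w))); apply: eq_wsum => w _.
  by rewrite eqseq_cons eqxx.
by rewrite -[RHS](wsum0 L V (size w0)); apply: eq_wsum => w _; rewrite eqseq_cons ne_yx.
Qed.

(** * Polynomials modulo the monomials that do not divide a given one *)

Section Vanishing.
Variables (N : nat) (S : comNzRingType).
Implicit Types (p q : {mpoly S[N]}) (a m : 'X_{1..N}).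

(** The ideal spanned by the monomials that do not divide X^a: computing modulo it keeps what
    matters for the coefficient at [a]. *)
Definition vanishes_upto a p := forall m, (m <= a)%MM -> p@_m = 0.

Lemma vanishes_uptoD a p q :
  vanishes_upto a p -> vanishes_upto a q -> vanishes_upto a (p + q).
Proof. by move=> E1 E2 m Hm; rewrite mcoeffD E1 ?E2 ?addr0. Qed.

Lemma vanishes_uptoM a p q : vanishes_upto a p -> vanishes_upto a (p * q).
Proof.
move=> E1 m Hm; rewrite mcoeffM big1 // => x /eqP Em; rewrite E1 ?mul0r //.
by apply: lepm_trans Hm; rewrite [X in (_ <= X)%MM]Em lem_addr.
Qed.

Lemma mcoeffXM_sub p a m :
  ('X_[a] * p)@_m = if (a <= m)%MM then p@_(m - a) else 0.
Proof.
rewrite mulrC; case: ifP => [le_am|lt_am].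
  by rewrite -{1}(submK le_am) addmC mcoeffMX.
rewrite mcoeffM big1 // => x /eqP Em.
rewrite mcoeffX; case: eqP => [Ea|]; last by rewrite mulr0.
by rewrite [X in (_ <= X)%MM]Em Ea lem_addl in lt_am.
Qed.

Lemma vanishes_uptoX a p (i : 'I_N) k :
  (a i < k)%N -> vanishes_upto a ('X_i ^+ k * p).
Proof.
move=> lt_ak m /mnm_lepP le_ma; rewrite mpolyXn mcoeffXM_sub.
case: ifP => // /mnm_lepP /(_ i); rewrite mulmnE mnm1E eqxx mul1n => le_km.
by have := leq_ltn_trans (le_ma i) lt_ak; rewrite ltnNge le_km.
Qed.

End Vanishing.

(** * Telescoping of products *)

Section Telescoping.
Variables (N : nat) (S : comNzRingType) (a : 'X_{1..N}).
Variables (c0 c1 e : {mpoly S[N]}) (M : nat -> {mpoly S[N]}).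
Variables (E p : 'I_N -> {mpoly S[N]}).
Hypothesis M0 : M 0 = c0 * e.
Hypothesis MN : M N = c1 * e.
Hypothesis pM : forall k : 'I_N, vanishes_upto a (p k * (M k.+1 - M k)).

Let pred_prod (F : 'I_N -> {mpoly S[N]}) j := \prod_(k < N | (k < j)%N) F k.

Let pred_prodS F (k : 'I_N) : pred_prod F k.+1 = pred_prod F k * F k.
Proof.
rewrite /pred_prod (bigD1 k) //= mulrC; congr (_ * _); apply: eq_bigl => i.
by rewrite -val_eqE /=; lia.
Qed.

(** Modulo the ideal, [M k] and [M k.+1] agree on multiples of [p k], and [M 0] and [M N] are both
    multiples of [e]. The differences of the two products from [\prod_k p k] therefore have a common
    cofactor, and comparing them at N gives the relation. *)
Lemma telescoping_products :
  vanishes_upto a (c0 * \prod_(k < N) (M k.+1 * E k + p k)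
    - c1 * \prod_(k < N) (M k * E k + p k) - (c0 - c1) * \prod_k p k).
Proof.
pose R (k : 'I_N) := M k.+1 * E k + p k; pose R' (k : 'I_N) := M k * E k + p k.
have pp0 F : pred_prod F 0 = 1 by rewrite /pred_prod big_pred0.
have ppN F : pred_prod F N = \prod_k F k.
  by apply: eq_bigl => k; rewrite ltn_ord.
(* [V] plays the role of the quotient of the second difference by [e]; carrying it as a witness
   avoids any division. *)
have step j : (j <= N)%N ->
    vanishes_upto a (pred_prod p j * M j - c0 * e * pred_prod p j) /\
    exists V, vanishes_upto a (pred_prod R' j - pred_prod p j - e * V) /\
       vanishes_upto a (c0 * pred_prod R j - c0 * pred_prod p j - M j * V).
  elim: j => [|j IH] lt_jN.
    rewrite !pp0 M0; split; first by rewrite mulr1 mul1r subrr => m; rewrite mcoeff0.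
    by exists 0; rewrite !mulr0 !subr0 !subrr; split=> m; rewrite mcoeff0.
  have [PM [V [EV' EV]]] := IH (ltnW lt_jN); pose k := Ordinal lt_jN.
  rewrite -[j]/(val k) !pred_prodS /= in PM EV' EV *.
  have pMk : vanishes_upto a (p k * (M j.+1 - M j)) := pM k.
  set P := pred_prod p j in PM EV' EV *.
  set A := pred_prod R j in PM EV' EV *.
  set A' := pred_prod R' j in PM EV' EV *.
  split.
    rewrite [X in vanishes_upto _ X](_ : _ =
      (p k * (M j.+1 - M j)) * P + (P * M j - c0 * e * P) * p k); last by ring.
    by apply: vanishes_uptoD; apply: vanishes_uptoM.
  (* The witness comes from writing the new difference as [(A' - P) * R' k + P * M j * E k] and
     replacing [P * M j] by [c0 * e * P]. *)
  exists (V * R' k + c0 * (P * E k)); split.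
    rewrite [X in vanishes_upto _ X](_ : _ =
      (A' - P - e * V) * R' k + (P * M j - c0 * e * P) * E k); last by rewrite /R' /=; ring.
    by apply: vanishes_uptoD; apply: vanishes_uptoM.
  rewrite [X in vanishes_upto _ X](_ : _ =
    (c0 * A - c0 * P - M j * V) * R k + (p k * (M j.+1 - M j)) * - V);
    last by rewrite /R /R' /=; ring.
  by apply: vanishes_uptoD; apply: vanishes_uptoM.
have [_ [V [EV' EV]]] := step N (leqnn N).
rewrite !ppN MN in EV' EV.
rewrite [X in vanishes_upto _ X](_ : _ =
   (c0 * \prod_k R k - c0 * \prod_k p k - c1 * e * V)
   + (\prod_k R' k - \prod_k p k - e * V) * - c1); last first.
  by rewrite /R /R'; ring.
by apply: vanishes_uptoD => //; apply: vanishes_uptoM.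
Qed.

End Telescoping.


(** * Generating functions of one block *)

Section Blocks.
Variables (N l : nat) (S : comNzRingType) (t r : S).

(* In a letter (c, i) the type i encodes the colour of a letter of the
   permutation: 0 is an excedance, and i > 0 is a non-excedance of colour
   l + 1 - i; there are l + 1 colours. *)
Definition vletter := ('I_N * 'I_l.+2)%type.

(** Here [k] is d_j for the position j of the letter, and [z.1] is d_i for the index i with |pi_i| =
    j. An excedance i < j forces d_i <= d_j, strictly if j opens its block; a non-excedance of color
    0 forces d_j <= d_i. *)
Definition allowed (first : bool) (k : 'I_N) (z : vletter) :=
  ((z.2 == ord0) ==> (if first then z.1 < k else z.1 <= k)%N)
    && ((z.2 == ord_max) ==> (k <= z.1)%N).

(** The letters carrying [r] are the trailing copies of [(k, ord_max)] in the block; they turn out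
    to be the fixed points. *)
Fixpoint block_weight first k (w : seq vletter) : S :=
  if w is z :: w' then
    (allowed first k z)%:R * r ^+ all (pred1 (k, ord_max)) w
      * block_weight false k w'
  else 1.

Definition type_weight (w : seq vletter) : S := \prod_(z <- w) t ^+ (l.+1 - z.2).

Definition content (w : seq vletter) : 'X_{1..N} := (\sum_(z <- w) U_(z.1))%MM.

Definition block_gf first k n : {mpoly S[N]} :=
  wsum n (fun w => (block_weight first k w * type_weight w) *: 'X_[content w]).

Definition color_sum : S := \sum_(i < l.+1) t ^+ i.

(** For [j = k] these are the letters allowed at the head of block k. Letting [j] run from 0 to N
    interpolates between two multiples of the sum of the variables, which is what telescopes. *)
Definition letter_gf j : {mpoly S[N]} :=
  \sum_(c < N) (if (c < j)%N then color_sum - 1 + t ^+ l.+1 else color_sum) *: 'X_c.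

Lemma type_sum first k (c : 'I_N) :
  \sum_(i < l.+2) (allowed first k (c, i))%:R * t ^+ (l.+1 - i) =
  (if (c < k + ~~ first)%N then t ^+ l.+1 else 0) + (color_sum - 1)
    + (k <= c)%N%:R.
Proof.
rewrite big_ord_recl big_ord_recr /= addrA; congr (_ + _ + _).
- rewrite /allowed /= andbT subn0; case: first => /=; rewrite ?addn0 ?addn1 ?ltnS.
    by case: ifP => _; rewrite ?mul1r ?mul0r.
  by case: ifP => _; rewrite ?mul1r ?mul0r.
- rewrite /color_sum big_ord_recl /= expr0 addrC addKr.
  rewrite [RHS](reindex_inj rev_ord_inj) /=; apply: eq_bigr => i _.
  rewrite /allowed -!val_eqE /= /bump /= add1n eqSS ltn_eqF ?ltn_ord //= mul1r.
  by congr (_ ^+ _); have := ltn_ord i; lia.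
- rewrite /allowed -!val_eqE /= /bump /= add1n.
  by rewrite eqxx subnn mulr1.
Qed.

Lemma allowed_letter_gf first k :
  \sum_(z : vletter)
     ((allowed first k z)%:R * t ^+ (l.+1 - z.2)) *: 'X_z.1 =
  letter_gf k + (if first then 0 else t ^+ l.+1 *: 'X_k) :> {mpoly S[N]}.
Proof.
rewrite -(pair_bigA _ (fun c i => ((allowed first k (c, i))%:R
   * t ^+ (l.+1 - i)) *: ('X_c : {mpoly S[N]}))) /=.
under eq_bigr => c _ do rewrite -scaler_suml type_sum.
rewrite /letter_gf.
have -> : (if first then 0 else t ^+ l.+1 *: 'X_k) =
   \sum_c (if first then 0 else (c == k)%:R * t ^+ l.+1) *: 'X_c :> {mpoly S[N]}.
  case: first; first by rewrite big1 // => c _; rewrite scale0r.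
  rewrite (bigD1 k) //= eqxx mul1r big1 ?addr0 // => c /negPf ->.
  by rewrite mul0r scale0r.
rewrite -big_split /=; apply: eq_bigr => c _; rewrite -scalerDl; congr (_ *: _).
case: first; rewrite /= ?addn0 ?addn1 ?ltnS -?val_eqE /=.
  by case: ltnP => _ /=; ring.
by case: (ltngtP c k) => _ /=; ring.
Qed.

Let rX k n : {mpoly S[N]} := r ^+ n *: 'X_k ^+ n.

Lemma block_gf0 first k : block_gf first k 0 = 1.
Proof. by rewrite /block_gf /= /type_weight /content !big_nil mulr1 scale1r mpolyX0. Qed.

Lemma sum_last_run k n :
  wsum n (fun w : seq vletter => ((all (pred1 (k, ord_max)) w)%:R
     * (block_weight false k w * type_weight w)) *: 'X_[content w]) = rX k n.
Proof.
rewrite /rX; elim: n => [|n IH] /=.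
  rewrite /type_weight /content !big_nil !mul1r !expr0 !scale1r.
  exact: mpolyX0.
rewrite (bigD1 (k, ord_max)) //= [X in _ + X]big1 ?addr0; last first.
  move=> z /negPf Hz; under eq_wsum => w _ do rewrite Hz /= mul0r scale0r.
  exact: wsum0.
rewrite !exprS -scalerA scalerAr -IH.
rewrite -(wsumMl _ 'X_k) -(mul_mpolyC r) -wsumMl.
apply: eq_wsum => w _; rewrite /allowed /= eqxx leqnn eqxx /= mul1r.
rewrite /type_weight /content !big_cons /= subnn expr0 mul1r mpolyXD mul_mpolyC.
case: (all _ w) => /=; last by rewrite !mul0r !scale0r !mulr0 scaler0.
by rewrite !mul1r -!scalerAr scalerA expr1 mulrA.
Qed.

(** Prepending a letter multiplies the weights, except that [(k, ord_max)] before a word of copies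
    of itself brings an extra [r]; the last summand corrects for this. *)
Lemma block_gfS first k n :
  block_gf first k n.+1 =
  (letter_gf k + (if first then 0 else t ^+ l.+1 *: 'X_k)) * block_gf false k n
    + (rX k n.+1 - 'X_k * rX k n).
Proof.
rewrite -allowed_letter_gf mulr_suml /block_gf /=.
have -> : rX k n.+1 - 'X_k * rX k n =
    \sum_(z : vletter) (z == (k, ord_max))%:R * (r - 1) *: ('X_k * rX k n).
  rewrite (bigD1 (k, ord_max)) //= eqxx mul1r big1 ?addr0; last first.
    by move=> z /negPf ->; rewrite mul0r scale0r.
  by rewrite scalerBl scale1r /rX !exprS -scalerA -!scalerAr.
rewrite -big_split /=; apply: eq_bigr => z _.
transitivity (wsum n (fun w =>
  ((allowed first k z)%:R * t ^+ (l.+1 - z.2)) *: 'X_z.1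
    * ((block_weight false k w * type_weight w) *: 'X_[content w])
  + (z == (k, ord_max))%:R * (r - 1) *: ('X_k * ((all (pred1 (k, ord_max)) w)%:R
     * (block_weight false k w * type_weight w) *: 'X_[content w])))).
  apply: eq_wsum => w _.
  rewrite /type_weight /content !big_cons mpolyXD -!scalerAl -!scalerAr !scalerA.
  case: eqP => [->|_] /=; last first.
    by rewrite !mul0r scale0r addr0 expr0; congr (_ *: _); ring.
  have -> : allowed first k (k, ord_max) by case: first; rewrite /allowed /= leqnn eqxx.
  rewrite subnn expr0 -scalerDl; congr (_ *: _).
  by case: all; rewrite /= ?expr0 ?expr1; ring.
rewrite wsumD wsumMl; congr (_ + _).
rewrite -mul_mpolyC -(sum_last_run k n) -!wsumMl; apply: eq_wsum => w _.
by rewrite mul_mpolyC.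
Qed.

End Blocks.


(** * Products of blocks and the recurrence for a fixed content *)

Section BlockProducts.
Variables (N l : nat) (S : comNzRingType) (t r : S).

Local Notation T := (t ^+ l.+1).
Local Notation gf := (@block_gf N l S t r).
Local Notation lgf := (@letter_gf N l S t).
Local Notation u := (color_sum l t).
Let run k n : {mpoly S[N]} := r ^+ n *: 'X_k ^+ n.

(** Padding block k by b_k copies of [c *: 'X_k] creates, in the product over k, the terms of
    content a - b with weight [c ^+ mdeg b]. *)
Definition padded_gf (c : S) k n : {mpoly S[N]} :=
  \sum_(b < n.+1) (c *: 'X_k) ^+ b * gf true k (n - b).

Lemma padded_gf0 c k : padded_gf c k 0 = 1.
Proof. by rewrite /padded_gf big_ord_recl big_ord0 addr0 expr0 mul1r block_gf0. Qed.

Lemma padded_gfS c k n :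
  padded_gf c k n.+1 = c *: 'X_k * padded_gf c k n + gf true k n.+1.
Proof.
rewrite /padded_gf big_ord_recl expr0 mul1r subn0 addrC; congr (_ + _).
by rewrite mulr_sumr; apply: eq_bigr => b _; rewrite lift0 subSS exprS mulrA.
Qed.

(* In the recursion below the factors [lgf k] and [lgf k.+1], which telescope
   over k, multiply the same polynomial in both paddings. *)
Fixpoint excess_gf k n : {mpoly S[N]} :=
  if n is n'.+1 then 'X_k * excess_gf k n' + gf false k n' else 0.

Lemma letter_gfS (k : 'I_N) : lgf k.+1 = lgf k + (T - 1) *: 'X_k.
Proof.
rewrite /letter_gf !(bigD1 (P := xpredT) k) //= ltnSn ltnn [RHS]addrAC -scalerDl.
congr (_ *: _ + _); first by ring.
by apply: eq_bigr => c /negPf; rewrite ltnS leq_eqVlt -val_eqE => /= ->.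
Qed.

Lemma nonfirst_gfE k n : gf false k n = lgf k.+1 * excess_gf k n + run k n.
Proof.
elim: n => [|n IH]; first by rewrite block_gf0 mulr0 add0r /run !expr0 scale1r.
have -> : lgf k.+1 * excess_gf k n.+1 =
    'X_k * (lgf k.+1 * excess_gf k n) + lgf k.+1 * gf false k n by move=> /=; ring.
have -> : lgf k.+1 * excess_gf k n = gf false k n - run k n by rewrite IH addrK.
rewrite block_gfS -/(run _ _) -/(run _ _) letter_gfS -!mul_mpolyC rmorphB rmorph1.
by ring.
Qed.

Lemma padded_gf1E k n : padded_gf 1 k n = lgf k * excess_gf k n + run k n.
Proof.
elim: n => [|n IH]; first by rewrite padded_gf0 mulr0 add0r /run !expr0 scale1r.
rewrite padded_gfS block_gfS IH -/(run _ _) -/(run _ _) scale1r addr0 /=; ring.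
Qed.

(** Padding by [T] turns a block into one whose head obeys the rule for inner letters: the two
    letter sets differ by [T *: 'X_k], so both sides obey the same recursion. *)
Lemma padded_gfTE k n : padded_gf T k n = lgf k.+1 * excess_gf k n + run k n.
Proof.
rewrite -nonfirst_gfE; elim: n => [|n IH]; first by rewrite padded_gf0 block_gf0.
by rewrite padded_gfS !block_gfS IH /= addr0 -/(run _ _) -/(run _ _) -!mul_mpolyC; ring.
Qed.

Definition valid_words_weight (a : 'X_{1..N}) : S :=
  (\prod_(k < N) gf true k (a k))@_a.

(** Both paddings have the shape [M * E + p] with the same [E] and [p], so the products telescope;
    the term [\prod_k p k] leaves r^|a|. *)
Lemma coef_padded_gf a :
  u * (\prod_(k < N) padded_gf T k (a k))@_a
    - (u - 1 + T) * (\prod_(k < N) padded_gf 1 k (a k))@_a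
  = (1 - T) * r ^+ mdeg a.
Proof.
have M0 : lgf 0 = u%:MP * \sum_(c < N) 'X_c.
  by rewrite mul_mpolyC scaler_sumr; apply: eq_bigr.
have MN : lgf N = (u - 1 + T)%:MP * \sum_(c < N) 'X_c.
  by rewrite mul_mpolyC scaler_sumr; apply: eq_bigr => i _; rewrite ltn_ord.
(* Consecutive [lgf] differ by a multiple of ['X_k], which raises ['X_k ^+ a k] beyond the exponent
   [a k]. *)
have pM k : vanishes_upto a (run k (a k) * (lgf k.+1 - lgf k)).
  rewrite letter_gfS addrC addKr /run -scalerAl -scalerAr -exprSr.
  move=> m le_ma; rewrite !mcoeffZ -(mulr1 ('X_k ^+ _)).
  by rewrite (vanishes_uptoX (a := a)) ?mulr0.
have /= := telescoping_products (fun k => excess_gf k (a k)) M0 MN pM (lepm_refl a).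
rewrite -(eq_bigr _ (fun k _ => padded_gfTE k (a k))).
rewrite -(eq_bigr _ (fun k _ => padded_gf1E k (a k))).
rewrite -rmorphB !mul_mpolyC !(mcoeffB, mcoeffZ) => /eqP; rewrite subr_eq0 => /eqP ->.
rewrite /run scaler_prod -mpolyXE_id mcoeffZ mcoeffX eqxx mulr1 prodrXr -mdegE.
by congr (_ * _); ring.
Qed.

(** Choosing the padding in every factor is choosing an exponent b <= a. The bound [B] makes the
    exponents a finite type. *)
Lemma coef_padded_prod c B (a : 'X_{1..N}) : (mdeg a < B)%N ->
  (\prod_(k < N) padded_gf c k (a k))@_a =
  \sum_(b : 'X_{1..N < B} | (b <= a)%MM) c ^+ mdeg b * valid_words_weight (a - b)%MM.
Proof.
move=> lt_aB.
have lt_B (k : 'I_N) : (a k < B)%N.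
  by apply: leq_ltn_trans lt_aB; rewrite mdegE (bigD1 k) //= leq_addr.
have B_gt0 : (0 < B)%N by case: B lt_aB {lt_B}.
transitivity ((\prod_(k < N) \sum_(b < B | (b <= a k)%N)
   (c *: 'X_k) ^+ b * gf true k (a k - b))@_a).
  congr (mcoeff _ _); apply: eq_bigr => k _; rewrite /padded_gf.
  rewrite -(big_mkord xpredT (fun b => (c *: 'X_k) ^+ b * gf true k (a k - b))).
  rewrite (big_nat_widen _ _ B) ?lt_B // big_mkord; apply: eq_bigl => b.
  by rewrite ltnS.
rewrite bigA_distr_big_dep raddf_sum /=.
pose h (f : {ffun 'I_N -> 'I_B}) := [multinom (f k : nat) | k < N].
have b0_lt : (mdeg (0%MM : 'X_{1..N}) < B)%N by rewrite mdeg0.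
pose b0 := BMultinom b0_lt.
pose h' (b : 'X_{1..N < B}) := [ffun k : 'I_N => insubd (Ordinal B_gt0) (b k)].
rewrite (reindex_onto h' (fun f => insubd b0 (h f))) /=; last first.
  move=> f /familyP f_le; apply/ffunP => k; rewrite ffunE.
  have lt_h : (mdeg (h f) < B)%N.
    apply: leq_ltn_trans lt_aB; rewrite !mdegE; apply: leq_sum => i _.
    by rewrite mnmE; apply: f_le.
  by apply: val_inj; rewrite !val_insubd lt_h mnmE ltn_ord.
have toK (b : 'X_{1..N < B}) k : insubd (Ordinal B_gt0) (bmnm b k) = b k :> nat.
  rewrite val_insubd ifT //; apply: leq_ltn_trans (bmdeg b).
  by rewrite mdegE (bigD1 k) //= leq_addr.
rewrite (eq_bigl (fun b : 'X_{1..N < B} => (b <= a)%MM)) => [|b]; last first.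
  rewrite -[RHS]andbT; congr (_ && _).
    apply/familyP/mnm_lepP => le_ba k; have := le_ba k.
      by rewrite ffunE unfold_in toK.
    by rewrite ffunE unfold_in toK.
  have -> : h [ffun k => insubd (Ordinal B_gt0) (b k)] = b.
    by apply/mnmP => k; rewrite mnmE ffunE toK.
  by apply/eqP; apply: val_inj; rewrite val_insubd bmdeg.
apply: eq_bigr => b le_ba; rewrite big_split /=.
under eq_bigr => k _ do rewrite ffunE toK exprZn.
rewrite scaler_prod -mpolyXE_id prodrXr -mdegE -scalerAl mcoeffZ mcoeffXM_sub le_ba.
rewrite /valid_words_weight; congr (_ * _@__); apply: eq_bigr => k _.
by rewrite ffunE toK mnmBE.
Qed.

(* Since hook_weight 0 = -1, the term m = 0 of the recurrences below is the
   quantity being computed. *)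
Definition hook_weight m : S := u * \sum_(i < m) T ^+ i - 1.

(** As (1 - T) h_m = (u - 1 + T) - u T^m, the combination of the paddings by 1 and by [T] is the sum
    with hook weights times 1 - T, which is then cancelled. *)
Lemma valid_words_recurrence B (a : 'X_{1..N}) :
  GRing.lreg (1 - T) -> (mdeg a < B)%N ->
  \sum_(b : 'X_{1..N < B} | (b <= a)%MM)
     hook_weight (mdeg b) * valid_words_weight (a - b)%MM = - r ^+ mdeg a.
Proof.
move=> regT lt_aB; apply: regT; rewrite mulrN -coef_padded_gf.
rewrite !(coef_padded_prod _ lt_aB) !mulr_sumr opprB -sumrB.
apply: eq_bigr => b _; rewrite expr1n mul1r !mulrA -mulrBl; congr (_ * _).
rewrite /hook_weight; have /eqP := subrX1 T (mdeg b); rewrite subr_eq => /eqP ->.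
by ring.
Qed.

End BlockProducts.


(** * Summation over contents of given degree *)

Lemma big_mnm_split N B n (V : nmodType) (F : 'X_{1..N} -> 'X_{1..N} -> V) :
  (n < B)%N ->
  \sum_(a : 'X_{1..N < B} | mdeg a == n)
     \sum_(b : 'X_{1..N < B} | (b <= a)%MM) F b (a - b)%MM =
  \sum_(m < n.+1) \sum_(b : 'X_{1..N < B} | mdeg b == m)
     \sum_(c : 'X_{1..N < B} | mdeg c == (n - m)%N) F b c.
Proof.
move=> lt_nB; have B_gt0 : (0 < B)%N by apply: leq_ltn_trans lt_nB.
have b0_lt : (mdeg (0%MM : 'X_{1..N}) < B)%N by rewrite mdeg0.
pose toB a : 'X_{1..N < B} := insubd (BMultinom b0_lt) a.
have toBK a : (mdeg a < B)%N -> toB a = a :> 'X_{1..N}.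
  by move=> lt_a; rewrite /toB val_insubd lt_a.
have le_mdeg a b : (b <= a)%MM -> (mdeg b <= mdeg a)%N.
  by move/mnm_lepP=> le_ba; rewrite !mdegE; apply: leq_sum => i _; apply: le_ba.
rewrite (exchange_big_dep xpredT) //= [RHS](exchange_big_dep xpredT) //=.
apply: eq_bigr => b _; case: (ltnP (mdeg b) n.+1) => [lt_bn|lt_nb]; last first.
  rewrite !big_pred0 // => [m|a].
    by apply/negbTE; rewrite neq_ltn orbC (leq_trans (ltn_ord m)).
  apply/negbTE/negP => /andP[/eqP deg_a /le_mdeg]; rewrite deg_a => le_bn.
  by have := leq_ltn_trans le_bn lt_nb; rewrite ltnn.
rewrite (big_pred1 (Ordinal lt_bn)) => [|m]; last by rewrite /= -val_eqE eq_sym.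
have deg_sub a : mdeg a = n -> (b <= a)%MM -> mdeg (a - b)%MM = (n - mdeg b)%N.
  by move=> <- le_ba; rewrite -{2}(submK le_ba) mdegD addnK.
rewrite (reindex_onto (fun c : 'X_{1..N < B} => toB (c + b)%MM)
                      (fun a : 'X_{1..N < B} => toB (a - b)%MM)) /=.
  apply: eq_big => [c|c /andP[/andP[_ le_bc] /eqP cK]]; last first.
    by rewrite -[in RHS]cK [in RHS]toBK // (leq_ltn_trans (mdegB _ _)) // bmdeg.
  apply/idP/eqP => [/andP[/andP[/eqP deg_c le_bc] /eqP cK]|deg_c].
    by rewrite -cK toBK ?deg_sub // ltnNge; apply/negP => /(leq_trans lt_nB); lia.
  have deg_cb : mdeg (c + b)%MM = n by rewrite mdegD deg_c subnK.
  rewrite toBK ?deg_cb // eqxx lem_addl /= addmK; apply/eqP/val_inj.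
  by rewrite /= toBK // bmdeg.
move=> a /andP[/eqP deg_a le_ba]; apply/val_inj => /=.
have lt_ab : (mdeg (a - b)%MM < B)%N by rewrite (leq_ltn_trans (mdegB _ _)) // bmdeg.
by rewrite (toBK (a - b)%MM) // submK // toBK // bmdeg.
Qed.

Section WeightedSums.
Variables (N l B : nat) (S : comNzRingType) (t r : S) (x : 'I_N -> S).

Definition mnm_eval (a : 'X_{1..N}) : S := \prod_(k < N) x k ^+ a k.

Lemma mnm_evalD a b : mnm_eval (a + b)%MM = mnm_eval a * mnm_eval b.
Proof.
by rewrite -big_split; apply: eq_bigr => k _; rewrite mnmDE exprD.
Qed.

(** For n < B, the complete homogeneous symmetric polynomial of degree n at [x]. *)
Definition complete_sum n : S :=
  \sum_(a : 'X_{1..N < B} | mdeg a == n) mnm_eval a.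

Definition valid_words_sum n : S :=
  \sum_(a : 'X_{1..N < B} | mdeg a == n) mnm_eval a * valid_words_weight l t r a.

Lemma valid_words_sum_recurrence n :
  GRing.lreg (1 - t ^+ l.+1) -> (n < B)%N ->
  \sum_(m < n.+1) hook_weight l t m * complete_sum m * valid_words_sum (n - m)%N =
  - (r ^+ n * complete_sum n).
Proof.
move=> regT lt_nB; rewrite -mulNr mulr_sumr.
transitivity (\sum_(a : 'X_{1..N < B} | mdeg a == n)
   \sum_(b : 'X_{1..N < B} | (b <= a)%MM) mnm_eval b * hook_weight l t (mdeg b) *
     (mnm_eval (a - b)%MM * valid_words_weight l t r (a - b)%MM)).
  rewrite (big_mnm_split (fun b c => mnm_eval b * hook_weight l t (mdeg b) *
     (mnm_eval c * valid_words_weight l t r c))) //.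
  apply: eq_bigr => m _; rewrite -[LHS]mulrA mulr_suml mulr_sumr.
  apply: eq_bigr => b /eqP ->; rewrite /valid_words_sum !mulr_sumr.
  by apply: eq_bigr => c _; ring.
apply: eq_bigr => a /eqP deg_a.
rewrite -deg_a -(valid_words_recurrence r regT (bmdeg a)) mulr_suml.
apply: eq_bigr => b le_ba.
by rewrite -[in RHS](submK le_ba) mnm_evalD addmK; ring.
Qed.

End WeightedSums.


(** * Weakly increasing words and their blocks *)

Section SortedWords.
Variables (N : nat).

Definition letter_content (d : seq 'I_N) : 'X_{1..N} := (\sum_(k <- d) U_(k))%MM.

Definition blocks (a : 'X_{1..N}) : seq 'I_N :=
  flatten [seq nseq (a k) k | k <- enum 'I_N].

Definition ord_leq (i j : 'I_N) := (i <= j)%N.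

Lemma letter_contentE d k : letter_content d k = count_mem k d.
Proof.
rewrite /letter_content mnm_sumE -sum1_count [RHS]big_mkcond /=.
by apply: eq_bigr => i _; rewrite mnm1E; case: eqP.
Qed.

Lemma mdeg_letter_content d : mdeg (letter_content d) = size d.
Proof.
by rewrite mdeg_sum (eq_bigr (fun=> 1%N)) ?sum1_size // => i _; rewrite mdeg1.
Qed.

Lemma count_blocks a k : count_mem k (blocks a) = a k.
Proof.
rewrite /blocks count_flatten -map_comp sumnE big_map big_enum (bigD1 k) //=.
rewrite count_nseq /= eqxx mul1n big1 ?addn0 // => i /negPf ne_ik.
by rewrite count_nseq /= ne_ik.
Qed.

Lemma letter_content_blocks a : letter_content (blocks a) = a.
Proof. by apply/mnmP => k; rewrite letter_contentE count_blocks. Qed.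

Lemma size_blocks a : size (blocks a) = mdeg a.
Proof. by rewrite -mdeg_letter_content letter_content_blocks. Qed.

Lemma sorted_blocks a : sorted ord_leq (blocks a).
Proof.
have: sorted ltn [seq val k | k <- enum 'I_N] by rewrite val_enum_ord iota_ltn_sorted.
rewrite sorted_map /blocks; elim: (enum 'I_N) => //= k ks IH.
rewrite (path_sortedE (leT := relpre val ltn)); last by move=> ? ? ?; apply: ltn_trans.
case/andP=> /allP gt_k /IH {}IH.
elim: (a k) => //= n; case: n => [|n] /=; last by rewrite /ord_leq leqnn => ->.
move=> _; rewrite (path_sortedE (leT := ord_leq)); last by move=> ? ? ?; apply: leq_trans.
rewrite IH andbT; apply/allP => i /flattenP[_ /mapP[j /gt_k lt_kj ->]].
by rewrite mem_nseq => /andP[_ /eqP ->]; apply: ltnW.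
Qed.

Lemma blocks_unique d : sorted ord_leq d -> d = blocks (letter_content d).
Proof.
move=> sorted_d; apply: (sorted_eq (leT := ord_leq)) => //.
- by move=> ? ? ?; apply: leq_trans.
- by move=> i j; rewrite /ord_leq -eqn_leq => /eqP /val_inj.
- exact: sorted_blocks.
- by apply/allP => k _ /=; rewrite count_blocks letter_contentE.
Qed.

Lemma mnm_eval_letter_content (S : comNzRingType) (x : 'I_N -> S) d :
  mnm_eval x (letter_content d) = \prod_(k <- d) x k.
Proof.
rewrite /letter_content; elim: d => [|k d IH].
  by rewrite !big_nil /mnm_eval big1 // => i _; rewrite mnm0E.
rewrite !big_cons mnm_evalD IH; congr (_ * _).
rewrite /mnm_eval (bigD1 k) //= big1 => [|i /negPf]; first by rewrite mnm1E eqxx mulr1.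
by rewrite mnm1E eq_sym => ->.
Qed.

Lemma complete_sumE B n (S : comNzRingType) (x : 'I_N -> S) : (n < B)%N ->
  complete_sum B x n =
  wsum n (fun d => if sorted ord_leq d then \prod_(k <- d) x k else 0).
Proof.
move=> lt_nB.
transitivity (wsum n (fun d => \sum_(a : 'X_{1..N < B} | mdeg a == n)
    (if d == blocks a then mnm_eval x a else 0))).
  rewrite wsum_sum; apply: eq_bigr => a /eqP deg_a.
  have <- : size (blocks a) = n by rewrite size_blocks.
  by rewrite (wsum_pred1 (blocks a) (fun=> mnm_eval x a)).
apply: eq_wsum => d size_d; rewrite -big_mkcondr /=; case: ifP => [sorted_d|nsorted_d].
  have lt_dB : (mdeg (letter_content d) < B)%N by rewrite mdeg_letter_content size_d.
  rewrite (big_pred1 (BMultinom lt_dB)) ?mnm_eval_letter_content // => a /=.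
  apply/andP/eqP => [[_ /eqP d_a]|->] /=.
    by apply: val_inj; rewrite /= d_a letter_content_blocks.
  by rewrite mdeg_letter_content size_d eqxx; split=> //; apply/eqP/blocks_unique.
apply: big_pred0 => a; apply/negbTE/negP => /andP[_ /eqP d_a].
by rewrite d_a sorted_blocks in nsorted_d.
Qed.

End SortedWords.

Section BlockDecomposition.
Variables (N l : nat) (S : comNzRingType) (t r : S).
Local Notation vletter := (vletter N l).

(* [s] lists pairs (d_j, v_j), where d is the increasing rearrangement of the
   values of v; [p] is the entry of d preceding [s]. *)
Fixpoint word_weight (p : option 'I_N) (s : seq ('I_N * vletter)) : S :=
  if s is y :: s' then
    (allowed (p != Some y.1) y.1 y.2)%:R
      * r ^+ all (fun y' => (y'.1 == y.1) ==> (y'.2 == (y.1, ord_max))) s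
      * word_weight (Some y.1) s'
  else 1.

(** The weight of a position involves only its own block and the preceding entry of d, so a block
    splits off. An empty block leaves the preceding entry unchanged. *)
Lemma word_weight_cat (p : option 'I_N) k n d (u v : seq vletter) :
  size u = n -> k \notin d ->
  word_weight p (zip (nseq n k ++ d) (u ++ v)) =
  block_weight r (p != Some k) k u
    * word_weight (if n is 0 then p else Some k) (zip d v).
Proof.
move=> <- {n} kd; elim: u p => [|z u IH] p /=; first by rewrite mul1r.
rewrite IH !eqxx /= -!mulrA; congr (_ * (_ ^+ (_ && _) * _)).
  elim: u {IH} => [|z' u IH] /=; last by rewrite eqxx IH.
  elim: d v kd => [|k' d IHd] [|z' v] //=.
  by rewrite inE negb_or eq_sym => /andP[/negPf -> /IHd ->].
by congr (_ * _); case: u {IH}.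
Qed.

Lemma word_weight_notin (p : option 'I_N) d (v : seq vletter) :
  (forall k, p = Some k -> k \notin d) ->
  word_weight p (zip d v) = word_weight None (zip d v).
Proof.
case: d v => [|k d] [|z v] //= p_notin; congr ((allowed _ _ _)%:R * _ * _).
case: p p_notin => //= k' /(_ _ erefl).
by rewrite inE negb_or => /andP[]; rewrite /eq_op /=.
Qed.

(** Cutting v along the blocks of d factors the sum over v. The coefficient at [a] will select the
    words v whose increasing rearrangement is this d. *)
Lemma word_weight_gf (a : 'X_{1..N}) :
  wsum (mdeg a) (fun v => (word_weight None (zip (blocks a) v) * type_weight t v)
     *: 'X_[content v]) = \prod_(k < N) block_gf l t r true k (a k).
Proof.
have -> : \prod_(k < N) block_gf l t r true k (a k) =
    \prod_(k <- enum 'I_N) block_gf l t r true k (a k) by rewrite big_enum.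
have -> : mdeg a = (\sum_(k <- enum 'I_N) a k)%N by rewrite big_enum mdegE.
rewrite /blocks.
have := enum_uniq 'I_N; elim: (enum 'I_N) => [|k ks IH] /= => [_|/andP[k_ks uniq_ks]].
  by rewrite !big_nil /= /type_weight /content !big_nil mulr1 scale1r mpolyX0.
rewrite !big_cons wsum_cat -IH // /block_gf -wsumMr.
apply: eq_wsum => u size_u; rewrite -wsumMl; apply: eq_wsum => v _.
have kd : k \notin flatten [seq nseq (a k') k' | k' <- ks].
  apply/flattenP => -[_ /mapP[k' k'_ks ->]]; rewrite mem_nseq => /andP[_ /eqP k_k'].
  by rewrite k_k' k'_ks in k_ks.
rewrite word_weight_cat // word_weight_notin; last first.
  by case: (a k) => // _ _ [<-].
rewrite /type_weight /content !big_cat mpolyXD -scalerAl -scalerAr scalerA.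
by congr (_ *: _); rewrite /=; ring.
Qed.

End BlockDecomposition.


(** * The permutation that sorts a word *)

Section SortingPermutation.
Variables (N l n : nat).
Local Notation vletter := (vletter N l).

Definition key_lt (x y : 'I_l.+2 * nat) :=
  (x.1 < y.1)%N || (x.1 == y.1) && (x.2 < y.2)%N.

(** Lexicographic on value, type and position; the position breaks ties, so that every word has
    exactly one sorting permutation. *)
Definition vkey_lt (x y : vletter * nat) :=
  (x.1.1 < y.1.1)%N || (x.1.1 == y.1.1) && key_lt (x.1.2, x.2) (y.1.2, y.2).

Lemma vkey_ltP (x y : vletter * nat) : reflect
  (x.1.1 < y.1.1 \/ x.1.1 = y.1.1 /\ (x.1.2 < y.1.2 \/ x.1.2 = y.1.2 /\ x.2 < y.2))%N
  (vkey_lt x y).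
Proof.
apply: (iffP orP) => [[|/andP[/eqP ? /orP[|/andP[/eqP ? ?]]]]|[|[-> [|[-> ?]]]]] /=;
  rewrite /key_lt /= ?eqxx; by [left | right; split; [|left] | right; split; [|right]
    | right; apply/orP; left | right; apply/orP; right].
Qed.

Lemma vkey_lt_trans : transitive vkey_lt.
Proof.
move=> y x z /vkey_ltP Hxy /vkey_ltP Hyz; apply/vkey_ltP; move: Hxy Hyz.
case=> [Hx|[-> [Hx|[-> Hx]]]] [Hy|[<- [Hy|[<- Hy]]]]; try by left; lia.
- by right; split=> //; left; lia.
- by right; split=> //; left; lia.
- by right; split=> //; left; lia.
- by right; split=> //; right; split=> //; lia.
Qed.

Definition letter_lt (v : {ffun 'I_n -> vletter}) (j j' : 'I_n) :=
  vkey_lt (v j, val j) (v j', val j').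

(** The sorting permutation recovers |pi|: [v (s i)] is the pair of d_i and the type of pi_i. *)
Definition sorts (v : {ffun 'I_n -> vletter}) (s : 'S_n) :=
  sorted (letter_lt v) [seq s i | i <- enum 'I_n].

Lemma sum_sorting_perm v : (\sum_(s : 'S_n) sorts v s = 1)%N.
Proof.
pose le (j j' : 'I_n) := (j == j') || letter_lt v j j'.
have le_trans : transitive le.
  move=> j2 j1 j3 /predU1P[->//|lt12] /predU1P[<-|lt23]; apply/predU1P; right=> //.
  exact: vkey_lt_trans lt12 lt23.
have lt_irr j : letter_lt v j j = false.
  by apply/vkey_ltP; case=> [|[_ [|[_]]]]; rewrite ltnn.
have le_anti : antisymmetric le.
  move=> j j' /andP[/predU1P[//|lt1] /predU1P[//|lt2]].
  by have := vkey_lt_trans lt1 lt2; rewrite [vkey_lt _ _]lt_irr.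
have le_total : total le.
  move=> j j'; rewrite /le; case: (eqVneq j j') => //= ne_jj'.
  apply/orP.
  have [H|H|/val_inj H1] := ltngtP (v j).1 (v j').1.
  - by left; apply/vkey_ltP; left.
  - by right; apply/vkey_ltP; left.
  have [H|H|/val_inj H2] := ltngtP (v j).2 (v j').2.
  - by left; apply/vkey_ltP; right; split=> //; left.
  - by right; apply/vkey_ltP; right; split=> //; left.
  have [H|H|/val_inj H3] := ltngtP j j'.
  - by left; apply/vkey_ltP; right; split=> //; right.
  - by right; apply/vkey_ltP; right; split=> //; right.
  by rewrite H3 eqxx in ne_jj'.
have size_w : size (sort le (enum 'I_n)) == n by rewrite size_sort size_enum_ord.
pose w := Tuple size_w.
have w_inj : injective (tnth w) by apply/tuple_uniqP; rewrite sort_uniq enum_uniq.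
have mapw : [seq perm w_inj i | i <- enum 'I_n] = w.
  by under eq_map => i do rewrite permE; rewrite map_tnth_enum.
have sorted_lt (u : seq 'I_n) : uniq u -> sorted le u -> sorted (letter_lt v) u.
  case: u => //= j u; elim: u j => //= j' u IH j /and3P[].
  rewrite inE negb_or => /andP[/negPf ne_jj' _] j'_u uniq_u /andP[].
  rewrite {1}/le ne_jj' /= => -> /= /IH -> //.
  by rewrite j'_u.
rewrite (bigD1 (perm w_inj)) //= big1 => [|s ne_s].
  by rewrite /sorts mapw sorted_lt ?sort_uniq ?enum_uniq ?sort_sorted.
apply/eqP; rewrite eqb0; apply: contraNN ne_s => sorted_s.
have Es : [seq s i | i <- enum 'I_n] = [seq perm w_inj i | i <- enum 'I_n].
  apply: (sorted_eq le_trans le_anti).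
  - by apply: sub_sorted sorted_s => j j' ltj; apply/orP; right.
  - by rewrite mapw sort_sorted.
  have perm_enum (s' : 'S_n) : perm_eq [seq s' i | i <- enum 'I_n] (enum 'I_n).
    apply: uniq_perm; rewrite ?enum_uniq ?(map_inj_uniq perm_inj) ?enum_uniq //.
    move=> j; rewrite mem_enum; apply/mapP; exists (s'^-1%g j); rewrite ?mem_enum //.
    by rewrite permKV.
  by rewrite (perm_trans (perm_enum _)) // perm_sym perm_enum.
by apply/eqP/permP => i; move/eq_in_map: Es; apply; rewrite mem_enum.
Qed.

End SortingPermutation.


(** * Validity and fixed points, position by position *)

Lemma word_weight_nth N l (S : comNzRingType) (r : S) y0 p
    (s : seq ('I_N * vletter N l)) :
  word_weight r p s = \prod_(i < size s)
    ((allowed ((if i : nat is i'.+1 then Some (nth y0 s i').1 else p)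
        != Some (nth y0 s i).1) (nth y0 s i).1 (nth y0 s i).2)%:R
    * r ^+ all (fun y => (y.1 == (nth y0 s i).1) ==>
                         (y.2 == ((nth y0 s i).1, ord_max))) (drop i s)).
Proof.
elim: s p => [|y s IH] p; first by rewrite big_ord0.
rewrite big_ord_recl /= IH; congr (_ * _); apply: eq_bigr => -[[|i] lt_i] _ //=.
Qed.

Section PositionwiseWeight.
Variables (N l n : nat) (S : comNzRingType) (r : S).
Variables (v : {ffun 'I_n -> vletter N l}) (s : 'S_n).

(** The types that arise from a coloring of [s]; the intermediate types, which are the positive
    colors, are unconstrained. *)
Definition compatible (s : 'S_n) (ty : 'I_n -> 'I_l.+2) :=
  [forall i, ((ty i == ord0) ==> (i < s i)%N) && ((ty i == ord_max) ==> (s i <= i)%N)].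

Hypothesis sorted_s : sorts v s.

Let d i := (v (s i)).1.
Let ty i := (v (s i)).2.

Lemma sorts_lt (i i' : 'I_n) : (i < i')%N -> letter_lt v (s i) (s i').
Proof.
have lt_trans : transitive (fun j j' => letter_lt v (s j) (s j')).
  by move=> y x z; apply: vkey_lt_trans.
move: sorted_s; rewrite /sorts sorted_map => /(sorted_ltn_nth lt_trans i) H lt_ii'.
have := H i i'; rewrite !inE size_enum_ord !nth_ord_enum => -> //; exact: ltn_ord.
Qed.

Lemma sorted_value (i i' : 'I_n) : (i <= i')%N -> (d i <= d i')%N.
Proof.
rewrite leq_eqVlt => /predU1P[/val_inj -> //|/sorts_lt /vkey_ltP[/ltnW //|[]]].
by rewrite /= -/(d i) -/(d i') => ->.
Qed.

Lemma sorted_type (i i' : 'I_n) : (i <= i')%N -> d i = d i' -> (ty i <= ty i')%N.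
Proof.
rewrite leq_eqVlt => /predU1P[/val_inj -> //|/sorts_lt /vkey_ltP /=].
rewrite -/(d i) -/(d i') -/(ty i) -/(ty i').
by case=> [lt_d eq_d|[_ [/ltnW //|[-> //]]]]; rewrite eq_d ltnn in lt_d.
Qed.

(** Value and type are constant between [i] and [i'], so ties are broken by position and [s] grows
    by at least 1 at each step. *)
Lemma sorted_position (i i' : 'I_n) :
  (i <= i')%N -> d i = d i' -> ty i = ty i' -> (s i + i' <= s i' + i)%N.
Proof.
move=> + eq_d eq_ty; move: {2}(i' - i)%N (erefl (i' - i)%N) => m.
elim: m i' eq_d eq_ty => [|m IH] i' eq_d eq_ty Em le_ii'.
  by have -> : i' = i by apply: val_inj => /=; lia.
have lt_c : (i'.-1 < n)%N by have := ltn_ord i'; lia.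
pose c := Ordinal lt_c; have le_ic : (i <= c)%N by rewrite /=; lia.
have le_ci' : (c <= i')%N by rewrite /=; lia.
have eq_dc : d i = d c.
  apply: val_inj; apply/eqP; rewrite eqn_leq sorted_value //=.
  by rewrite eq_d sorted_value.
have eq_tyc : ty i = ty c.
  apply: val_inj; apply/eqP; rewrite eqn_leq sorted_type //=.
  by rewrite eq_ty sorted_type // -eq_dc.
have := IH c eq_dc eq_tyc; have : (s c < s i')%N.
  have : (c < i')%N by rewrite /=; lia.
  move=> /sorts_lt /vkey_ltP /=; rewrite -/(d c) -/(d i') -/(ty c) -/(ty i').
  by rewrite -eq_dc -eq_tyc eq_d eq_ty !ltnn; case=> // -[_ [|[]]].
by rewrite /=; lia.
Qed.

Definition first_in_block (j : 'I_n) :=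
  [forall i : 'I_n, (i < j)%N ==> (d i != d j)].

(** Since d is weakly increasing, comparing i with [s i] yields a comparison of d-values.
    Conversely, a violation can be moved to the boundary of its block, which it would have to leave
    without changing the value of d. *)
Lemma compatible_allowed :
  compatible s ty = [forall j, allowed (first_in_block j) (d j) (v j)].
Proof.
apply/forallP/forallP => [comp j | valid i].
  have /andP[/implyP comp0 /implyP compM] := comp (s^-1 j)%g.
  rewrite /ty permKV in comp0 compM.
  have vj : (v j).1 = d (s^-1 j)%g by rewrite /d permKV.
  apply/andP; split; apply/implyP => Hty.
    have lt_j := comp0 Hty; have le_d := sorted_value (ltnW lt_j).
    case: ifP => [/forallP/(_ (s^-1 j)%g)|_]; last by rewrite vj.
    by rewrite lt_j vj /= ltn_neqAle le_d andbT.
  by rewrite vj; apply: sorted_value; apply: compM.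
have vs : (v (s i)).1 = d i by [].
apply/andP; split; apply/implyP => /eqP ty_i.
  rewrite ltnNge; apply/negP => le_si.
  have eq_d : d (s i) = d i.
    apply: val_inj; apply/eqP; rewrite eqn_leq sorted_value //=.
    have := valid (s i); rewrite /allowed -/(ty i) ty_i eqxx /= -/(d i).
    by case/andP => + _; case: ifP => // _ /ltnW.
  (* Types 0 come first in a block, so the violation propagates to its first
     position a. *)
  pose a := [arg min_(b < i | d b == d i) (b : nat)]%N.
  have [da a_min] : d a = d i /\ forall b, d b = d i -> (a <= b)%N.
    rewrite /a; case: arg_minnP => // b /eqP db b_min; split=> // c /eqP.
    exact: b_min.
  have le_ai : (a <= i)%N by apply: a_min.
  have ty_a : ty a = ord0.
    apply/eqP; rewrite -val_eqE /= -leqn0.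
    by have := sorted_type le_ai da; rewrite ty_i.
  have le_sa : (s a <= a)%N.
    by have := sorted_position le_ai da (etrans ty_a (esym ty_i)); lia.
  have := valid (s a); rewrite /allowed -/(ty a) ty_a eqxx /= -/(d a) => /andP[le_da _].
  have eq_da : d (s a) = d i.
    rewrite -da; apply: val_inj; apply/eqP; rewrite eqn_leq sorted_value //=.
    by move: le_da; case: ifP => // _ /ltnW.
  have fix_a : s a = a.
    by apply: val_inj; apply/eqP; rewrite eqn_leq le_sa a_min.
  move: le_da; rewrite fix_a ltnn ifT //; apply/forallP => b; apply/implyP => lt_ba.
  by apply/negP => /eqP db; have := a_min b (etrans db da); rewrite leqNgt lt_ba.
rewrite leqNgt; apply/negP => lt_is.
have := valid (s i); rewrite /allowed -/(ty i) ty_i eqxx /= -/(d i).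
move=> le_ds.
(* Dually, the types [ord_max] come last in a block, so the violation propagates to its last
   position a. *)
pose a := [arg max_(b > i | d b == d i) (b : nat)]%N.
have [da a_max] : d a = d i /\ forall b, d b = d i -> (b <= a)%N.
  rewrite /a; case: arg_maxnP => // b /eqP db b_max; split=> // c /eqP.
  exact: b_max.
have le_ia : (i <= a)%N by apply: a_max.
have ty_a : ty a = ord_max.
  apply/eqP; rewrite -val_eqE /= eqn_leq -ltnS ltn_ord /=.
  by have := sorted_type le_ia (esym da); rewrite ty_i.
have lt_as : (a < s a)%N.
  by have := sorted_position le_ia (esym da) (etrans ty_i (esym ty_a)); lia.
have := valid (s a); rewrite /allowed -/(ty a) ty_a eqxx /= -/(d a) => le_da.
have /a_max : d (s a) = d i.
  rewrite -da; apply: val_inj; apply/eqP; rewrite eqn_leq le_da /=.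
  by apply: sorted_value; apply: ltnW.
by rewrite leqNgt lt_as.
Qed.

(** From a fixed point of type [ord_max] on, all types in the block are [ord_max]; there [s i - i]
    is at most 0 by compatibility and at least 0 by [sorted_position]. *)
Lemma fixed_trailing j : compatible s ty ->
  ((ty j == ord_max) && (s j == j)) =
  [forall j' : 'I_n, (j <= j')%N ==> (d j' == d j) ==> (v j' == (d j, ord_max))].
Proof.
move=> /forallP comp.
have compM i : ty i = ord_max -> (s i <= i)%N.
  by move=> ty_i; have /andP[_] := comp i; rewrite ty_i eqxx.
apply/andP/forallP => [[/eqP ty_j /eqP sj] j'|trail].
  apply/implyP => le_jj'; apply/implyP => /eqP dj'.
  have ty_j' : ty j' = ord_max.
    apply/eqP; rewrite -val_eqE /= eqn_leq -ltnS ltn_ord /=.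
    by have := sorted_type le_jj' (esym dj'); rewrite ty_j.
  have sj' : s j' = j'.
    have := sorted_position le_jj' (esym dj') (etrans ty_j (esym ty_j')).
    by have := compM _ ty_j'; rewrite sj => H1 H2; apply: val_inj => /=; lia.
  by rewrite -{1}sj' -dj' -ty_j' [v _]surjective_pairing.
have vj (j' : 'I_n) : (j <= j')%N -> d j' = d j -> v j' = (d j, ord_max).
  by move=> le_jj' /eqP dj'; apply/eqP; have := trail j'; rewrite le_jj' dj'.
(* Downward induction along the block: the index of the letter at j' is at least j', and the larger
   indices of the block are already fixed. *)
have fixed (j' : 'I_n) : (j <= j')%N -> d j' = d j -> s j' = j'.
  move: {2}(n - j')%N (leqnn (n - j')%N) => m; elim: m j' => [|m IH] j' le_m le_jj' dj'.
    by have := ltn_ord j'; lia.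
  have v_j' := vj _ le_jj' dj'; pose i := (s^-1 j')%g.
  have [di ty_i] : d i = d j /\ ty i = ord_max by rewrite /d /ty permKV v_j'.
  have le_j'i : (j' <= i)%N by have := compM _ ty_i; rewrite permKV.
  move: le_j'i; rewrite leq_eqVlt => /predU1P[/val_inj Ei|lt_j'i].
    by rewrite {1}Ei permKV.
  have si : s i = i by apply: IH => //; have := ltn_ord i; lia.
  by move: lt_j'i; rewrite -{1}si permKV ltnn.
by rewrite fixed // eqxx /ty fixed // vj.
Qed.

Lemma sorted_word_weight :
  word_weight r None (zip (blocks (content [seq v j | j <- enum 'I_n]))
                          [seq v j | j <- enum 'I_n]) =
  (compatible s ty)%:R * r ^+ #|[pred j | (ty j == ord_max) && (s j == j)]|.
Proof.
have -> : content [seq v j | j <- enum 'I_n] = letter_content [seq d i | i <- enum 'I_n].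
  rewrite /content /letter_content [LHS]big_map [RHS]big_map !big_enum /=.
  by rewrite (reindex_inj (@perm_inj _ s)).
rewrite -blocks_unique; last first.
  rewrite sorted_map; have : sorted ltn [seq val i | i <- enum 'I_n].
    by rewrite val_enum_ord iota_ltn_sorted.
  by rewrite sorted_map; apply: sub_sorted => i i' /ltnW; apply: sorted_value.
rewrite zip_map; set y := map _ _.
case: (posnP n) => [n0|n_gt0].
  have no_ord (i : 'I_n) : False by have := ltn_ord i; rewrite {2}n0.
  have -> : y = [::] by apply: size0nil; rewrite size_map size_enum_ord.
  rewrite eq_card0 => [|i]; last by case: (no_ord i).
  have -> : compatible s ty by apply/forallP => i; case: (no_ord i).
  by rewrite mulr1.
pose y0 := (d (Ordinal n_gt0), v (Ordinal n_gt0)).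
have size_y : size y = n by rewrite size_map size_enum_ord.
have nth_y (j : 'I_n) : nth y0 y j = (d j, v j).
  by rewrite (nth_map (Ordinal n_gt0)) ?size_enum_ord // nth_ord_enum.
have all_drop (P : pred ('I_N * vletter N l)) (j : 'I_n) :
    all P (drop j y) = [forall j' : 'I_n, (j <= j')%N ==> P (d j', v j')].
  apply/(all_nthP y0)/forallP => [H j'|H i].
    apply/implyP => le_jj'; have := H (j' - j)%N; rewrite size_drop size_y nth_drop.
    by rewrite subnKC // nth_y; apply; have := ltn_ord j'; lia.
  rewrite size_drop size_y => lt_i; have lt_ji : (j + i < n)%N by lia.
  have := H (Ordinal lt_ji); rewrite /= leq_addr /= nth_drop.
  by rewrite -[(j + i)%N]/(val (Ordinal lt_ji)) nth_y.
have firstE (j : 'I_n) : (if j : nat is i'.+1 then Some (nth y0 y i').1 else None)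
      != Some (nth y0 y j).1 = first_in_block j.
  rewrite nth_y; case Ej : (j : nat) => [|i].
    by apply/esym/forallP => i; rewrite Ej.
  have lt_i : (i < n)%N by have := ltn_ord j; lia.
  rewrite -[i]/(val (Ordinal lt_i)) nth_y /=; apply/idP/forallP => [ne_d i'|].
    apply/implyP => lt_i'j; apply: contraNneq ne_d => eq_d; apply/eqP; congr Some.
    apply: val_inj; apply/eqP; rewrite eqn_leq -{2}eq_d !sorted_value //=; lia.
  by move/(_ (Ordinal lt_i)); rewrite /= Ej ltnSn.
rewrite (word_weight_nth _ y0) size_y.
transitivity (\prod_(j < n) ((allowed (first_in_block j) (d j) (v j))%:R
    * r ^+ [forall j' : 'I_n, (j <= j')%N ==> (d j' == d j) ==> (v j' == (d j, ord_max))])).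
  by apply: eq_bigr => j _; rewrite firstE all_drop nth_y.
case: (boolP (compatible s ty)) => [comp|ncomp]; last first.
  move: ncomp; rewrite compatible_allowed => /forallPn[j /negPf nallowed].
  by rewrite (bigD1 j) //= nallowed !mul0r.
have /forallP allowed_v : [forall j, allowed (first_in_block j) (d j) (v j)].
  by rewrite -compatible_allowed.
rewrite mul1r -sum1_card [X in _ ^+ X]big_mkcond /= -prodrXr; apply: eq_bigr => j _.
by rewrite allowed_v mul1r -fixed_trailing // inE; case: ifP.
Qed.

End PositionwiseWeight.


(** * From words to typed permutations *)

Lemma mnm_eval_content N l (S : comNzRingType) (x : 'I_N -> S) (w : seq (vletter N l)) :
  mnm_eval x (content w) = \prod_(z <- w) x z.1.
Proof.
by rewrite -(big_map fst xpredT x) -mnm_eval_letter_content /letter_content big_map.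
Qed.

Section TypedPermutations.
Variables (N l B n : nat) (S : comNzRingType) (t r : S) (x : 'I_N -> S).

Lemma valid_words_sumE : (n < B)%N ->
  valid_words_sum l B t r x n =
  wsum n (fun v : seq (vletter N l) => mnm_eval x (content v)
    * word_weight r None (zip (blocks (content v)) v) * type_weight t v).
Proof.
move=> lt_nB.
transitivity (wsum n (fun v : seq (vletter N l) =>
    \sum_(a : 'X_{1..N < B} | mdeg a == n) (mnm_eval x a
      * word_weight r None (zip (blocks a) v) * type_weight t v) *+ (content v == a))).
  rewrite wsum_sum; apply: eq_bigr => a /eqP deg_a.
  rewrite /valid_words_weight -word_weight_gf deg_a.
  rewrite (wsum_additive (mcoeff a)) -wsumMl; apply: eq_wsum => v _ /=.
  by rewrite mcoeffZ mcoeffX -!mulrA mulr_natr -!mulrnAr.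
apply: eq_wsum => v size_v.
have deg_v : mdeg (content v) = n.
  by rewrite /content mdeg_sum (eq_bigr (fun=> 1%N)) ?sum1_size // => i _; rewrite mdeg1.
have lt_vB : (mdeg (content v) < B)%N by rewrite deg_v.
rewrite (bigD1 (BMultinom lt_vB)) /= ?deg_v // eqxx mulr1n big1 ?addr0 //.
move=> a /andP[_ /negPf ne_a]; case: eqP => // Ea.
by move/eqP: ne_a; case; apply: val_inj.
Qed.

Definition increasing_keys (s : 'S_n) (d : 'I_n -> 'I_N) (ty : 'I_n -> 'I_l.+2) :=
  sorted (fun i i' => vkey_lt ((d i, ty i), val (s i)) ((d i', ty i'), val (s i')))
    (enum 'I_n).

Lemma valid_words_sum_perm : (n < B)%N ->
  valid_words_sum l B t r x n =
  \sum_(s : 'S_n) \sum_(ty : {ffun 'I_n -> 'I_l.+2} | compatible s ty)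
    (\prod_i t ^+ (l.+1 - ty i))
      * r ^+ #|[pred j | (ty j == ord_max) && (s j == j)]|
      * \sum_(d : {ffun 'I_n -> 'I_N} | increasing_keys s d ty) \prod_i x (d i).
Proof.
move=> lt_nB; rewrite valid_words_sumE // -wsum_ffun.
(* A sum over the permutations sorting [v] is inserted; there is exactly one. *)
transitivity (\sum_(v : {ffun 'I_n -> vletter N l}) \sum_(s : 'S_n | sorts v s)
  (\prod_i x (v i).1) * ((compatible s (fun i => (v (s i)).2))%:R *
    r ^+ #|[pred j | ((v (s j)).2 == ord_max) && (s j == j)]|) *
    \prod_i t ^+ (l.+1 - (v i).2)).
  apply: eq_bigr => v _; rewrite mnm_eval_content /type_weight.
  rewrite [X in X * _ * _]big_map [X in _ * _ * X]big_map !big_enum /=.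
  set a := \prod_i x _; set b := \prod_i t ^+ _; set w := word_weight _ _ _.
  transitivity (\sum_(s : 'S_n | sorts v s) a * w * b).
    rewrite big_mkcond /= -[LHS]mulr1n -(sum_sorting_perm v) -sumrMnr.
    by apply: eq_bigr => s _; case: sorts.
  by apply: eq_bigr => s sorted_s; rewrite /w (sorted_word_weight r sorted_s).
rewrite (exchange_big_dep xpredT) //=; apply: eq_bigr => s _.
(* For fixed [s], words correspond to pairs of types and values: the i-th pair is written at
   position [s i]. *)
pose h (p : {ffun 'I_n -> 'I_l.+2} * {ffun 'I_n -> 'I_N}) : {ffun 'I_n -> vletter N l} :=
  [ffun j => (p.2 (s^-1 j)%g, p.1 (s^-1 j)%g)].
have h_bij : bijective h.
  exists (fun v : {ffun 'I_n -> vletter N l} =>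
    ([ffun i => (v (s i)).2], [ffun i => (v (s i)).1])) => [[ty d]|v].
    by congr pair; apply/ffunP => i; rewrite !ffunE /= permK.
  by apply/ffunP => j; rewrite !ffunE /= permKV -surjective_pairing.
rewrite (reindex h) /=; last exact: onW_bij.
under [RHS]eq_bigr do rewrite mulr_sumr.
rewrite pair_big_dep big_mkcond [RHS]big_mkcond /=; apply: eq_bigr => -[ty d] _ /=.
have -> : sorts (h (ty, d)) s = increasing_keys s d ty.
  rewrite /sorts sorted_map /increasing_keys; apply: eq_sorted => i i'.
  by rewrite /= /letter_lt !ffunE /= !permK.
have tyE i : (h (ty, d) (s i)).2 = ty i by rewrite ffunE /= permK.
have -> : compatible s (fun i => (h (ty, d) (s i)).2) = compatible s ty.
  by apply: eq_forallb => i; rewrite tyE.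
rewrite andbC; case: increasing_keys => //=; case: compatible; rewrite ?mul0r ?mulr0 ?mul0r //.
rewrite mul1r [LHS]mulrC [X in _ * X]mulrC mulrA; congr (_ * _ * _).
- by rewrite (reindex_inj (@perm_inj _ s)); apply: eq_bigr => i _; rewrite tyE.
- congr (_ ^+ _); apply: eq_card => i; by rewrite !inE tyE.
- by rewrite (reindex_inj (@perm_inj _ s)); apply: eq_bigr => i _; rewrite ffunE /= permK.
Qed.

End TypedPermutations.


(** * Sums over increasing sequences at powers of q *)

Lemma wsum_rev (L : finType) (V : nmodType) k (f : seq L -> V) :
  wsum k (fun w => f (rev w)) = wsum k f.
Proof.
elim: k f => [|k IH] f //.
rewrite -[in RHS]addn1 wsum_cat /= -IH wsum_sum /=; apply: eq_bigr => x _.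
by apply: eq_wsum => w _; rewrite rev_cons cats1.
Qed.

Section Chains.
Variables (N : nat) (S : comNzRingType) (q : S).
Hypothesis qN : q ^+ N = 0.

(** Larger values get smaller exponents, so a strict increase of d after its i-th entry raises the
    first i exponents. *)
Let x (k : 'I_N) : S := q ^+ (N.-1 - k).

(* As q^N = 0, this is 1 / (1 - q^i) for i > 0. *)
Definition geometric i : S := \sum_(c < N) q ^+ (i * c).

Definition geometric_prod n : S := \prod_(i < n) geometric i.+1.

Lemma geometricK i : (0 < i)%N -> (1 - q ^+ i) * geometric i = 1.
Proof.
move=> i_gt0; rewrite /geometric; under eq_bigr do rewrite exprM.
rewrite -opprB mulNr -subrX1 exprAC qN expr0n.
by case: i i_gt0 => // i _; rewrite sub0r opprK.
Qed.

(** Because q^N = 0, moving the start of the geometric series by m only multiplies it by a power of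
    q. *)
Lemma geometric_tail i m : (0 < i)%N ->
  \sum_(k < N | (m <= N.-1 - k)%N) x k ^+ i = q ^+ (i * m) * geometric i.
Proof.
move=> i_gt0; rewrite (reindex_inj rev_ord_inj) /= mulr_sumr.
rewrite (eq_bigl (fun k : 'I_N => (m <= k)%N)) => [|k]; last first.
  by congr (_ <= _)%N; have := ltn_ord k; lia.
rewrite (eq_bigr (fun k : 'I_N => q ^+ (i * k))) => [|k _]; last first.
  by rewrite /x -exprM mulnC; congr (_ ^+ (_ * _)); have := ltn_ord k; rewrite /=; lia.
under [RHS]eq_bigr do rewrite -exprD -mulnDr.
have q0 k : (N <= k)%N -> q ^+ (i * k) = 0.
  by move=> le_Nk; rewrite -(subnK le_Nk) mulnDr exprD mulnC exprM mulnC [q ^+ (_ * i)]exprM qN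
    expr0n; case: i i_gt0 => // ? _; rewrite mulr0.
rewrite -(big_geq_mkord _ _ xpredT (fun k => q ^+ (i * k))) -{1}[m]add0n big_addn.
rewrite -(big_mkord xpredT (fun k => q ^+ (i * (m + k)))).
rewrite [RHS](big_cat_nat _ (n := N - m)) ?leq_subr //=.
rewrite [X in _ = _ + X]big_nat [X in _ = _ + X]big1 ?addr0.
  by apply: eq_bigr => k _; rewrite addnC.
by move=> k /andP[le_k _]; apply: q0; lia.
Qed.

Fixpoint descending_chain (e : nat) (bs : seq bool) (d : seq 'I_N) :=
  match bs, d with
  | b :: bs', k :: d' => (k + b <= e)%N && descending_chain k bs' d'
  | _, _ => true
  end.

Fixpoint descent_sum (bs : seq bool) : nat :=
  if bs is b :: bs' then (b * size bs + descent_sum bs')%N else 0%N.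

(** By induction the entries after the first one, k, contribute a power of [x k], and
    [geometric_tail] sums over k. A strict drop shifts all entries from there on, which accounts for
    its weight in [descent_sum]. *)
Lemma chain_sum e bs : (e <= N.-1)%N ->
  wsum (size bs) (fun d => if descending_chain e bs d then \prod_(k <- d) x k else 0) =
  q ^+ (size bs * (N.-1 - e)) * (q ^+ descent_sum bs * geometric_prod (size bs)).
Proof.
elim: bs e => [|b bs IH] e le_e /=.
  by rewrite big_nil /geometric_prod big_ord0 !expr0 !mul1r.
rewrite /geometric_prod big_ord_recr /= -/(geometric_prod _).
transitivity (\sum_(k < N | (N.-1 - e + b <= N.-1 - k)%N) x k ^+ (size bs).+1
   * (q ^+ descent_sum bs * geometric_prod (size bs))).
  rewrite [RHS]big_mkcond; apply: eq_bigr => k _ /=.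
  have -> : (k + b <= e)%N = (N.-1 - e + b <= N.-1 - k)%N by have := ltn_ord k; lia.
  case: ifP => _ /=; last exact: wsum0.
  have le_k : (k <= N.-1)%N by have := ltn_ord k; lia.
  rewrite exprS -mulrA /x -exprM mulnC -IH // -wsumMl; apply: eq_wsum => d _.
  by rewrite big_cons; case: ifP; rewrite ?mulr0.
rewrite -mulr_suml geometric_tail // (mulnC b).
by move: (size bs).+1 => m; rewrite mulnDr !exprD; ring.
Qed.

Section Keys.
Variables (K : Type) (lt : rel K).

Definition value_key_lt (y y' : 'I_N * K) :=
  (y.1 < y'.1)%N || (y.1 == y'.1) && lt y.2 y'.2.

(** The leading [false] leaves the last entry of d free up to N - 1. *)
Definition reverse_descents (ks : seq K) : seq bool :=
  if ks is k :: ks' then false :: pairmap (fun k0 k1 => ~~ lt k1 k0) k ks' else [::].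

Lemma sorted_value_key d ks : size d = size ks ->
  sorted value_key_lt (zip d ks) =
  descending_chain N.-1 (reverse_descents (rev ks)) (rev d).
Proof.
move=> eq_size; rewrite -[zip d ks]revK rev_sorted rev_zip //.
case: (rev ks) (rev d) => [|k ks'] [|e d'] //=.
have -> : (e + false <= N.-1)%N by have := ltn_ord e; lia.
elim: ks' e k d' => [|k1 ks' IH] e k [|e1 d'] //=.
rewrite IH; congr (_ && _); rewrite /value_key_lt /= -val_eqE.
by case: lt; rewrite /= ?andbT ?andbF ?orbF ?addn0 ?addn1 // orbC -leq_eqVlt.
Qed.

Lemma size_reverse_descents ks : size (reverse_descents ks) = size ks.
Proof. by case: ks => //= k ks; rewrite size_pairmap. Qed.

(** Read from the right, a descent after the i-th key is followed by exactly i entries, so it is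
    counted with weight i as in maj. *)
Lemma descent_sum_rev k0 ks :
  descent_sum (reverse_descents (rev ks)) =
  (\sum_(i < (size ks).-1) ~~ lt (nth k0 ks i) (nth k0 ks i.+1) * i.+1)%N.
Proof.
elim/last_ind: ks => [|ks k IH]; first by rewrite big_ord0.
rewrite rev_rcons size_rcons; case/lastP: ks IH => [|ks k1] IH.
  by rewrite big_ord0.
rewrite [in RHS]size_rcons big_ord_recr /= !nth_rcons !size_rcons ltnSn eqxx ltnn.
move: IH; rewrite size_rcons rev_rcons /= !mul0n !add0n => ->.
rewrite addnC; congr (_ + _)%N; last first.
  by rewrite size_pairmap size_rev ltnn eqxx.
apply: eq_bigr => i _; have lt_i := ltn_ord i.
rewrite [in RHS]nth_rcons size_rcons ltnS ltnW //.
by rewrite (nth_rcons _ (rcons ks k1)) size_rcons ltnS lt_i.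
Qed.

Lemma value_key_sum ks :
  wsum (size ks) (fun d => if sorted value_key_lt (zip d ks) then \prod_(k <- d) x k else 0)
  = q ^+ descent_sum (reverse_descents (rev ks)) * geometric_prod (size ks).
Proof.
rewrite -wsum_rev -[in RHS](size_rev ks) -[in RHS](size_reverse_descents (rev ks)).
rewrite -[RHS]mul1r -[X in X * _](expr0 q).
rewrite -[X in _ ^+ X * _](muln0 (size (reverse_descents (rev ks)))).
rewrite -(subnn N.-1) -chain_sum // size_reverse_descents size_rev.
apply: eq_wsum => d size_d; rewrite sorted_value_key ?size_rev // revK.
by rewrite (perm_big d) // perm_rev.
Qed.

End Keys.

(** A key comparison that always holds imposes no strict increase, which leaves all weakly
    increasing sequences. *)
Lemma complete_sum_geometric B n : (n < B)%N -> complete_sum B x n = geometric_prod n.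
Proof.
move=> lt_nB; rewrite complete_sumE //.
have := value_key_sum (fun _ _ : unit => true) (nseq n tt).
rewrite (descent_sum_rev _ tt) size_nseq big1 => [|i _]; last by rewrite mul0n.
rewrite expr0 mul1r => <-; apply: eq_wsum => d size_d; congr (if _ then _ else _).
rewrite -size_d; case: d {size_d} => //= k d; elim: d k => //= k' d IH k.
by rewrite IH /value_key_lt /= andbT /ord_leq -val_eqE orbC -leq_eqVlt.
Qed.

Lemma increasing_keys_sum l n (s : 'S_n) (ty : 'I_n -> 'I_l.+2) :
  \sum_(d : {ffun 'I_n -> 'I_N} | increasing_keys s d ty) \prod_i x (d i) =
  q ^+ (\sum_(i < n.-1)
     let ks := [seq (ty i, val (s i)) | i <- enum 'I_n] in
     ~~ key_lt (nth (ord0, 0%N) ks i) (nth (ord0, 0%N) ks i.+1) * i.+1)%N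
  * geometric_prod n.
Proof.
pose ks := [seq (ty i, val (s i)) | i <- enum 'I_n].
have size_ks : size ks = n by rewrite size_map size_enum_ord.
have := value_key_sum (@key_lt l) ks.
rewrite (descent_sum_rev _ (ord0, 0%N)) size_ks => <-.
rewrite -wsum_ffun big_mkcond; apply: eq_bigr => d _.
rewrite big_map big_enum /=; congr (if _ then _ else _).
rewrite zip_map sorted_map /increasing_keys; apply: eq_sorted => i i'.
by [].
Qed.

End Chains.


(** * Statistics of colored permutations in terms of types *)

(** Summation by parts. It will be used with [C] the descents of the colored word, [D] those of the
    word of keys and [X] the indicator of excedances. *)
Lemma weighted_exchange (X C D : nat -> nat) n :
  (forall i, (i < n)%N -> C i + X i.+1 = D i + X i)%N ->
  (\sum_(i < n) C i * i.+1 + n * X n = \sum_(i < n) X i + \sum_(i < n) D i * i.+1)%N.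
Proof.
elim: n => [|n IH] H; first by rewrite !big_ord0.
rewrite !big_ord_recr /=; have Hn := H n (ltnSn n).
have {}IH := IH (fun i lt_i => H i (ltnW lt_i)).
have : (C n * n.+1 + n.+1 * X n.+1 = (D n + X n) * n.+1)%N.
  by rewrite -Hn mulnC -mulnDr mulnC.
move: IH; set a := (\sum_(i < n) C i * _)%N; set b := (\sum_(i < n) X i)%N.
by set c := (\sum_(i < n) _)%N; nia.
Qed.

Section ColoredPermutationStatistics.
Variables (l n : nat) (s : 'S_n) (e : {ffun 'I_n -> 'I_l.+1}).
Local Notation w := (cword s e).

Lemma size_cword : size w = n.
Proof. by rewrite size_map size_enum_ord. Qed.

Lemma cnth_cword (i : 'I_n) : cnth w i = ((s i).+1, val (e i)).
Proof. by rewrite /cnth (nth_map i) ?size_enum_ord ?nth_ord_enum. Qed.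

Lemma csumcol_cword : csumcol w = (\sum_i e i)%N.
Proof. by rewrite /csumcol /cword -map_comp sumnE big_map big_enum. Qed.

Lemma count_iota_ord (P : pred nat) m : count P (iota 0 m) = (\sum_(i < m) P i)%N.
Proof.
rewrite -sum1_count big_mkcond -(big_mkord xpredT (fun i => P i : nat)) /=.
by rewrite /index_iota subn0; apply: eq_bigr => i _; case: (P i).
Qed.

Definition excedance (i : 'I_n) := (e i == ord0) && (i < s i)%N.

Definition color_type : {ffun 'I_n -> 'I_l.+2} :=
  [ffun i => if excedance i then ord0 else inord (l.+1 - e i)].

Lemma color_typeE i :
  val (color_type i) = if excedance i then 0%N else (l.+1 - e i)%N.
Proof. by rewrite ffunE; case: ifP => //= _; rewrite inordK // ltnS leq_subr. Qed.

Lemma cexc_cword : cexc w = (\sum_i excedance i)%N.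
Proof.
rewrite /cexc size_cword count_iota_ord; apply: eq_bigr => i _.
by rewrite cnth_cword /= ltnS /excedance -val_eqE.
Qed.

Lemma cfexc_cword : cfexc l.+1 w = (\sum_i (l.+1 - color_type i))%N.
Proof.
rewrite /cfexc cexc_cword csumcol_cword big_distrr -big_split /=.
apply: eq_bigr => i _; rewrite color_typeE /excedance -val_eqE /=.
by have := ltn_ord (e i); case: ifP; lia.
Qed.

Lemma cfix_cword :
  cfix w = #|[pred j | (color_type j == ord_max) && (s j == j)]|.
Proof.
rewrite /cfix size_cword count_iota_ord -sum1_card [RHS]big_mkcond /=.
apply: eq_bigr => i _; rewrite inE -!val_eqE color_typeE cnth_cword /= xpair_eqE eqSS.
have := ltn_ord (e i); rewrite /excedance -val_eqE /=.
case: (ltngtP i (s i)); rewrite ?andbT ?andbF //=; case: eqP => e0 //=;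
  try (by lia); by move=> _ lt_e; case: eqP => //; lia.
Qed.

Lemma compatible_color_type : compatible s color_type.
Proof.
apply/forallP => i; rewrite -!val_eqE color_typeE /excedance -val_eqE /=.
have := ltn_ord (e i); case: (boolP (_ && (i < s i)%N)) => [/andP[_ ->]|] //=.
by move=> nexc lt_e; apply/andP; split; apply/implyP; lia.
Qed.

Lemma cmaj_cword :
  cmaj w = (cexc w + \sum_(i < n.-1)
     let ks := [seq (color_type i, val (s i)) | i <- enum 'I_n] in
     ~~ key_lt (nth (ord0, 0%N) ks i) (nth (ord0, 0%N) ks i.+1) * i.+1)%N.
Proof.
set ks := map _ _ => /=.
have nth_ks (i : 'I_n) : nth (ord0, 0%N) ks i = (color_type i, val (s i)).
  by rewrite (nth_map i) ?size_enum_ord ?nth_ord_enum.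
pose X i : nat := (ccol (cnth w i) == 0) && (i.+1 < cabs (cnth w i))%N.
pose D i : nat := ~~ key_lt (nth (ord0, 0%N) ks i) (nth (ord0, 0%N) ks i.+1).
pose C i : nat := clt (cnth w i.+1) (cnth w i).
rewrite /cmaj size_cword big_mkord big_mkcond /=.
rewrite (eq_bigr (fun i : 'I_n.-1 => C i * i.+1)%N); last first.
  by move=> i _; rewrite /C; case: clt; rewrite ?mul1n ?mul0n.
have -> : cexc w = (\sum_(i < n) X i)%N by rewrite /cexc size_cword count_iota_ord.
case: (posnP n) => [n0|n_gt0].
  by rewrite !big1 // => -[i lt_i]; exfalso; rewrite n0 in lt_i.
(* The last letter is never an excedance, so the boundary term of the summation by parts
   vanishes. *)
have X_last : X n.-1 = 0%N.
  have lt_last : (n.-1 < n)%N by rewrite prednK.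
  rewrite /X -[n.-1]/(val (Ordinal lt_last)) cnth_cword /= prednK //.
  by have := ltn_ord (s (Ordinal lt_last)); case: eqP => //=; lia.
have := @weighted_exchange X C D n.-1; rewrite X_last muln0 addn0 => ->.
  by rewrite -[in RHS](prednK n_gt0) big_ord_recr /= X_last addn0.
(* Between an excedance and a non-excedance exactly one of the two words
   descends; elsewhere both or neither do. *)
move=> i lt_i; have lt_in : (i < n)%N by lia.
have lt_in1 : (i.+1 < n)%N by lia.
pose j := Ordinal lt_in; pose j' := Ordinal lt_in1.
rewrite /X /C /D -[i]/(val j) -[(val j).+1]/(val j') !cnth_cword !nth_ks.
rewrite /clt /key_lt /= -val_eqE !color_typeE /excedance -!val_eqE /=.
have ne_s : s j <> s j' :> nat.
  by move/val_inj/perm_inj/(congr1 val) => /=; lia.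
have := ltn_ord (e j); have := ltn_ord (e j'); rewrite !ltnS.
move: ne_s; move: (nat_of_ord (s j)) (nat_of_ord (s j')) => a a'.
move: (nat_of_ord (e j)) (nat_of_ord (e j')) => c c' ne_a le_c' le_c.
case: (ltnP i a) => lt_a; case: (ltnP i.+1 a') => lt_a';
  case: (posnP c) => c0; case: (posnP c') => c'0;
  rewrite /= ?c0 ?c'0 ?(gtn_eqF c0) ?(gtn_eqF c'0) /=; try (by lia).
Qed.

End ColoredPermutationStatistics.

(** Types 0 and [ord_max] both become color 0; the permutation tells them apart again, through its
    excedances. *)
Definition color_of_type l n (ty : {ffun 'I_n -> 'I_l.+2}) : {ffun 'I_n -> 'I_l.+1} :=
  [ffun i => if ty i == ord0 then ord0 else inord (l.+1 - ty i)].

Lemma color_of_typeE l n (ty : {ffun 'I_n -> 'I_l.+2}) i :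
  color_of_type ty i = (if ty i == ord0 then 0 else l.+1 - ty i)%N :> nat.
Proof.
rewrite ffunE -val_eqE /=; case: eqP => //= ty0; rewrite inordK //.
by have := ltn_ord (ty i); lia.
Qed.

Lemma color_of_typeK l n (s : 'S_n) (ty : {ffun 'I_n -> 'I_l.+2}) :
  compatible s ty -> color_type s (color_of_type ty) = ty.
Proof.
move=> /forallP comp; apply/ffunP => i; apply: val_inj.
rewrite color_typeE /excedance -!val_eqE /= color_of_typeE -val_eqE /=.
have := comp i; rewrite -!val_eqE /=; have := ltn_ord (ty i).
case: (posnP (ty i)) => [-> _|ty_gt0 lt_ty] /=; first by case/andP => ->.
case: (ltnP i (s i)) => /= _; rewrite ?andbF ?andbT ?implybF; last by lia.
by move=> ne_ty; case: eqP; lia.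
Qed.

Lemma color_typeK l n (s : 'S_n) (e : {ffun 'I_n -> 'I_l.+1}) :
  color_of_type (color_type s e) = e.
Proof.
apply/ffunP => i; apply: val_inj; rewrite /= color_of_typeE -val_eqE /= color_typeE.
rewrite /excedance -val_eqE /=; have := ltn_ord (e i).
case: (ltnP i (s i)) => _; rewrite ?andbT ?andbF; last by case: eqP => //; lia.
by case: (posnP (e i)) => [->|e_gt0] //= lt_e; case: eqP; lia.
Qed.

(** * The Eulerian side as a sum over valid words *)

Section EulerianSide.
Variables (l n N B : nat) (S : comNzRingType) (t r q : S).

Definition eulerian_sum : S :=
  \sum_(s : 'S_n) \sum_(e : {ffun 'I_n -> 'I_l.+1})
    t ^+ cfexc l.+1 (cword s e) * r ^+ cfix (cword s e)
      * q ^+ (cmaj (cword s e) - cexc (cword s e)).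

(** For fixed [s], colorings biject with compatible types, and summing over d gives q^(maj - exc)
    times P_n. *)
Lemma eulerian_sum_valid_words : q ^+ N = 0 -> (n < B)%N ->
  eulerian_sum * geometric_prod N q n =
  valid_words_sum l B t r (fun k : 'I_N => q ^+ (N.-1 - k)) n.
Proof.
move=> qN lt_nB; rewrite valid_words_sum_perm // /eulerian_sum mulr_suml.
apply: eq_bigr => s _; rewrite mulr_suml.
rewrite (reindex_onto (color_type s) (@color_of_type l n)) /=; last first.
  by move=> ty; apply: color_of_typeK.
apply: eq_big => [e|e _].
  by rewrite color_typeK eqxx compatible_color_type.
rewrite increasing_keys_sum // mulrA cfexc_cword cfix_cword cmaj_cword addKn.
by congr (_ * _ * _ * _); rewrite prodrXr.
Qed.

End EulerianSide.


(** * The colored hook factorization as a parse from the right *)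

Definition plain_increasing (w : seq cint) :=
  all (fun x => ccol x == 0) w && sorted ltn (cabsw w).

(** The first component is the pending plain increasing prefix of what has been read; a letter that
    cannot extend it closes a hook. *)
Fixpoint hook_parse (w : seq cint) : seq cint * seq (seq cint) :=
  if w is x :: w' then
    let: (p, ts) := hook_parse w' in
    if plain_increasing (x :: p) then (x :: p, ts) else ([::], (x :: p) :: ts)
  else ([::], [::]).

Lemma plain_increasing_behead x w :
  plain_increasing (x :: w) -> plain_increasing w.
Proof. by case/andP=> /= /andP[_ w0] /path_sorted sw; apply/andP. Qed.

Lemma colored_hook_cons (w : seq cint) : colored_hook w ->
  exists x u, [/\ w = x :: u, plain_increasing u & ~~ plain_increasing (x :: u)].
Proof.
case: w => // x u; rewrite /colored_hook /hook /plain_increasing /=.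
case/orP => [/andP[/and3P[size_u lt_u sorted_u] u0]|/and3P[sorted_u gt0 u0]];
  exists x, u; split=> //; rewrite ?u0 ?andbT //=.
- case: u size_u lt_u {sorted_u u0} => //= y u _ lt_yx.
  by rewrite [(cabs x < _)%N]ltnNge (ltnW lt_yx) andbF.
- exact: path_sorted sorted_u.
- by move: gt0; rewrite /cnth /= lt0n => /negPf ->.
Qed.

(** As absolute values are distinct, a head that breaks the prefix exceeds its successor or has
    positive color, and each case is one kind of colored hook. *)
Lemma plain_increasing_hook x p :
  plain_increasing p -> uniq (cabsw (x :: p)) -> ~~ plain_increasing (x :: p) ->
  colored_hook (x :: p).
Proof.
rewrite /plain_increasing /colored_hook /hook /= => /andP[-> sorted_p] /andP[x_p _].
rewrite /cnth /= !andbT; case: p sorted_p x_p => [|y p] /= sorted_p.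
  by rewrite lt0n !andbT => _ ->.
rewrite inE negb_or sorted_p !andbT lt0n => /andP[ne_xy _].
by case: ltngtP ne_xy => //= _ _; rewrite andbT.
Qed.

Lemma hook_parse_cat u w ts :
  plain_increasing u -> hook_parse w = ([::], ts) -> hook_parse (u ++ w) = (u, ts).
Proof.
move=> + parse_w; elim: u => //= x u IH inc_xu.
by rewrite IH ?inc_xu //; apply: plain_increasing_behead inc_xu.
Qed.

(** After reading [v] the pending prefix is empty, as at the start, so [w] is parsed as if [v] were
    absent. *)
Lemma hook_parse_rcons w v :
  colored_hook v ->
  hook_parse (w ++ v) = ((hook_parse w).1, rcons (hook_parse w).2 v).
Proof.
move=> /colored_hook_cons[y [u [-> inc_u ninc]]]; elim: w => [|x w IH] /=.
  have := hook_parse_cat inc_u (erefl (hook_parse [::])); rewrite cats0 => ->.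
  by rewrite (negPf ninc).
by rewrite IH; case: (hook_parse w) => p ts /=; case: ifP.
Qed.

Lemma hook_parse_flatten p ts :
  plain_increasing p -> all colored_hook ts -> hook_parse (p ++ flatten ts) = (p, ts).
Proof.
move=> inc_p hook_ts; apply: hook_parse_cat => //.
elim/last_ind: ts hook_ts => // ts t IH; rewrite all_rcons => /andP[hook_t /IH parse_ts].
by rewrite flatten_rcons hook_parse_rcons ?parse_ts.
Qed.

Lemma hook_parseP w : uniq (cabsw w) ->
  [/\ w = (hook_parse w).1 ++ flatten (hook_parse w).2,
      plain_increasing (hook_parse w).1 & all colored_hook (hook_parse w).2].
Proof.
elim: w => //= x w IH /andP[x_w /IH]; case: (hook_parse w) => p ts [/= def_w inc_p hook_ts].
case: ifP => [inc_xp|/negbT ninc] /=; first by rewrite -def_w.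
split; rewrite -?def_w //= hook_ts andbT; apply: plain_increasing_hook => //.
rewrite /= -/(cabsw _); case/andP: inc_p => _; rewrite ltn_sorted_uniq_leq => /andP[-> _].
rewrite andbT; apply: contraNN x_w; rewrite def_w /cabsw map_cat mem_cat.
by move->.
Qed.

Section Factorizations.
Variable w : seq cint.

Lemma fact_cat st :
  sorted leq st -> all (fun i => i <= size w)%N st ->
  fact_p w st ++ flatten (fact_taus w st) = w.
Proof.
have fact a st' : path leq a st' -> all (fun i => i <= size w)%N (a :: st') ->
    flatten (fact_taus w (a :: st')) = drop a w.
  elim: st' a => [|b st' IH] a /= => [_ _|/andP[le_ab path_b] /and3P[_ le_b all_b]].
    by rewrite /fact_taus /= take_size cats0.
  have := IH b path_b; rewrite /= le_b all_b => /(_ isT).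
  rewrite {1}/fact_taus /= => E; rewrite /fact_taus /= E.
  by rewrite -[in RHS](cat_take_drop b w) drop_cat size_takel ?ltn_neqAle //;
     case: ltngtP le_ab => // -> _; rewrite drop_oversize ?subnn ?drop0 // size_takel.
case: st => [|a st] sorted_st all_st.
  by rewrite /fact_p /fact_taus /= cats0 take_size.
by rewrite fact // /fact_p cat_take_drop.
Qed.

Fixpoint starting_positions a (ts : seq (seq cint)) : seq nat :=
  if ts is t :: ts' then a :: starting_positions (a + size t) ts' else [::].

Lemma starting_positionsP p ts :
  w = p ++ flatten ts -> all (fun t => t != [::]) ts ->
  [/\ fact_p w (starting_positions (size p) ts) = p,
      fact_taus w (starting_positions (size p) ts) = ts,
      sorted ltn (starting_positions (size p) ts) &
      all (fun i => i < size w)%N (starting_positions (size p) ts)].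
Proof.
move=> def_w ts_neq0; split.
- case: ts def_w {ts_neq0} => [|t ts] -> /=; first by rewrite cats0 /fact_p take_size.
  by rewrite /fact_p /= take_size_cat.
- rewrite def_w /fact_taus; move: p {def_w}; elim: ts ts_neq0 => //= t ts IH /andP[_ /IH {}IH] p.
  have {IH} := IH (p ++ t); rewrite size_cat -catA.
  have Eh : head (size (p ++ t ++ flatten ts)) (starting_positions (size p + size t) ts)
      = (size p + size t)%N.
    by case: ts => //=; rewrite cats0 size_cat.
  move: Eh; case: (starting_positions _ ts) => [|b st] /= Eh.
    rewrite Eh => <-; rewrite -size_cat catA take_size_cat ?drop_size_cat //.
  rewrite Eh => ->; congr (_ :: _).
  by rewrite -size_cat catA take_size_cat // drop_size_cat.
- move: (size p); elim: ts ts_neq0 {def_w} => //= t ts IH /andP[t_neq0 /IH {}IH] a.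
  have := IH (a + size t)%N; case: ts {IH} => //= t' ts ->.
  by rewrite andbT -addn1 leq_add2l lt0n size_eq0.
rewrite def_w; move: p {def_w}; elim: ts ts_neq0 => //= t ts IH /andP[t_neq0 /IH {}IH] p.
rewrite !size_cat; have := IH (p ++ t); rewrite !size_cat addnA => ->.
rewrite andbT -addnA -addn1 leq_add2l ltn_addr // lt0n size_eq0 //.
Qed.

End Factorizations.

Lemma starts_sorted n (X : {set 'I_n}) : sorted ltn (starts X).
Proof.
have: sorted ltn [seq val i | i <- enum 'I_n] by rewrite val_enum_ord iota_ltn_sorted.
rewrite /starts !sorted_map; apply: subseq_sorted; first by move=> ? ? ?; apply: ltn_trans.
exact: filter_subseq.
Qed.

(** The parser reproduces every factorization, hence the one picked; and one exists, because the
    output of the parser has a set of starting positions. *)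
Lemma chf_hook_parse n (w : seq cint) :
  size w = n -> uniq (cabsw w) -> chf n w = hook_parse w.
Proof.
move=> size_w uniq_w; have [def_w inc_p hook_ts] := hook_parseP uniq_w.
rewrite /chf; case: pickP => [X /and3P[p0 inc_p' hook_ts']|no_fact].
  have all_st : all (fun i => i <= size w)%N (starts X).
    by apply/allP => _ /mapP[i _ ->]; rewrite size_w; apply/ltnW/ltn_ord.
  have E := fact_cat (sub_sorted (fun i j => @ltnW i j) (starts_sorted X)) all_st.
  by rewrite -[in RHS]E hook_parse_flatten //; apply/andP.
have ts_neq0 : all (fun t => t != [::]) (hook_parse w).2.
  by apply: sub_all hook_ts => t /colored_hook_cons[x [u [-> _ _]]].
have [] := starting_positionsP def_w ts_neq0; set st := starting_positions _ _.
move=> def_p def_ts sorted_st; rewrite size_w => /allP lt_st.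
pose X : {set 'I_n} := [set i | val i \in st].
have def_st : starts X = st.
  apply: (irr_sorted_eq ltn_trans ltnn (starts_sorted X) sorted_st) => i.
  apply/mapP/idP => [[j + ->]|st_i]; first by rewrite mem_enum inE.
  by exists (Ordinal (lt_st i st_i)); rewrite // mem_enum inE.
have := no_fact X; rewrite def_st /is_chf def_p def_ts hook_ts andbT.
by case/negP; case/andP: inc_p => -> ->.
Qed.


(** * Inversions and words on a given set of letters *)

Lemma invw_cons x u : invw (x :: u) = (\sum_(y <- u) (y < x) + invw u)%N.
Proof.
rewrite /invw /= big_nat_recl //=; congr (_ + _)%N.
  by rewrite big_add1 /= [RHS](big_nth 0%N).
by apply: eq_bigr => i _; rewrite big_add1.
Qed.

Lemma invw_cat u v :
  invw (u ++ v) = (invw u + invw v + \sum_(x <- u) \sum_(y <- v) (y < x))%N.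
Proof.
elim: u => [|x u IH]; first by rewrite big_nil addn0 {2}/invw big_geq.
rewrite cat_cons !invw_cons IH big_cat big_cons /= -!addnA; congr (_ + _)%N.
by rewrite addnCA; congr (_ + _)%N; rewrite addnCA.
Qed.

Lemma invw_sorted u : sorted ltn u -> invw u = 0%N.
Proof.
elim: u => [|x u IH] /=; first by rewrite /invw big_geq.
rewrite (path_sortedE ltn_trans) => /andP[/allP gt_x /IH inv0].
rewrite invw_cons inv0 addn0 big_seq big1 // => y /gt_x lt_xy.
by rewrite ltnNge ltnW.
Qed.

Section HookWords.
Variables (n l : nat).
Definition cletter := ('I_n * 'I_l.+1)%type.
Implicit Types (w u v : seq cletter) (A X : {set 'I_n}).

Definition cword_of w : seq cint := [seq ((val z.1).+1, val z.2) | z <- w].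

Definition word_on A w := uniq (unzip1 w) && ([set i in unzip1 w] == A).

Definition crossings A X := (\sum_(i in A) \sum_(j in X) (j < i))%N.

Lemma cabsw_cword_of w : cabsw (cword_of w) = [seq (val i).+1 | i <- unzip1 w].
Proof. by rewrite /cabsw /cword_of /unzip1 -!map_comp. Qed.

Lemma uniq_cabsw w : uniq (cabsw (cword_of w)) = uniq (unzip1 w).
Proof. by rewrite cabsw_cword_of map_inj_uniq // => i j [/val_inj]. Qed.

Lemma word_on_uniq A w : word_on A w -> uniq (cabsw (cword_of w)).
Proof. by rewrite uniq_cabsw => /andP[]. Qed.

Lemma size_word_on A w : word_on A w -> size w = #|A|.
Proof.
case/andP=> /card_uniqP; rewrite size_map => <- /eqP <-.
by apply: eq_card => i; rewrite inE.
Qed.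

Lemma word_on_sum A w (F : 'I_n -> nat) :
  word_on A w -> (\sum_(i <- unzip1 w) F i = \sum_(i in A) F i)%N.
Proof.
case/andP=> uniq_w /eqP <-; rewrite big_uniq //.
by apply: eq_bigl => i; rewrite inE.
Qed.

Lemma word_on_crossings A X u v : word_on A u -> word_on X v ->
  (\sum_(x <- cabsw (cword_of u)) \sum_(y <- cabsw (cword_of v)) (y < x))%N =
  crossings A X.
Proof.
move=> on_u on_v; rewrite cabsw_cword_of big_map (word_on_sum _ on_u).
apply: eq_bigr => i _; rewrite cabsw_cword_of big_map (word_on_sum _ on_v).
by apply: eq_bigr.
Qed.

(** Only the letter set of [v] contributes. The numerical form lets the sum over X be exchanged with
    sums over words. *)
Lemma word_on_cat A u v :
  (word_on A (u ++ v) : nat) =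
  (\sum_(X : {set 'I_n} | X \subset A) (word_on (A :\: X) u && word_on X v))%N.
Proof.
rewrite (bigID (fun X => X == [set i in unzip1 v])) /= addnC big1 ?add0n; last first.
  move=> X /andP[_ ne_X].
  case: (boolP (word_on X v)) => [/andP[_ /eqP Xv]|_]; last by rewrite andbF.
  by rewrite Xv eqxx in ne_X.
case: (boolP ([set i in unzip1 v] \subset A)) => [sub_vA|nsub]; last first.
  rewrite big_pred0 => [|X]; last by case: eqP => [->|]; rewrite ?andbF // (negPf nsub).
  apply/eqP; rewrite eqb0; apply: contraNN nsub => /andP[_ /eqP <-].
  by apply/subsetP => i; rewrite !inE /unzip1 map_cat mem_cat => ->; rewrite orbT.
rewrite (big_pred1 [set i in unzip1 v]) => [|X]; last first.
  by rewrite /=; case: eqP => [->|]; rewrite ?andbF ?sub_vA.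
congr nat_of_bool; rewrite /word_on /unzip1 map_cat cat_uniq eqxx andbT.
set U := map _ u; set V := map _ v in sub_vA *.
case: (boolP (uniq U)) => //= _; rewrite [RHS]andbC.
case: (boolP (uniq V)); rewrite ?andbF //= => _.
rewrite andbT; apply/andP/eqP => [[disj /eqP UV_A]|U_A].
  apply/setP => i; rewrite -UV_A !inE mem_cat.
  case: (boolP (i \in V)) => [i_V|_]; last by rewrite orbF.
  by apply/negbTE; apply: contra disj => i_U; apply/hasP; exists i.
split.
  apply/hasPn => i i_V; apply/negP => i_U; have : i \in [set i in U] by rewrite inE.
  by rewrite U_A !inE i_V.
apply/eqP/setP => i; rewrite inE mem_cat.
have := congr1 (fun W : {set 'I_n} => i \in W) U_A; rewrite !inE => ->.
case: (boolP (i \in V)) => //= i_V; last by rewrite orbF.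
by apply/esym/(subsetP sub_vA); rewrite inE.
Qed.

End HookWords.


(** * Removal of the last hook *)

Lemma plain_or_hook x w : uniq (cabsw (x :: w)) ->
  (plain_increasing (x :: w) + colored_hook (x :: w) = plain_increasing w)%N.
Proof.
move=> uniq_xw; case: (boolP (plain_increasing w)) => [inc_w|ninc].
  case: (boolP (plain_increasing (x :: w))) => [inc_xw|ninc_xw].
    case: (boolP (colored_hook _)) => // /colored_hook_cons[y [u [[<- <-] _]]].
    by rewrite inc_xw.
  by rewrite plain_increasing_hook.
have /negPf -> : ~~ plain_increasing (x :: w).
  by apply: contra ninc; apply: plain_increasing_behead.
case: (boolP (colored_hook _)) => // /colored_hook_cons[y [u [[_ <-]]]].
by rewrite (negPf ninc).
Qed.

(** Suffixes of growing length stay plain increasing until one is a hook; no longer suffix is a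
    hook, as its tail is no longer plain. *)
Lemma unique_last_hook w : uniq (cabsw w) ->
  (plain_increasing w + \sum_(i < size w) colored_hook (drop i w) = 1)%N.
Proof.
elim: w => [_|x w IH] /=; first by rewrite big_ord0.
by move=> uniq_xw; rewrite big_ord_recl /= addnA plain_or_hook // IH //; case/andP: uniq_xw.
Qed.

Lemma cabsw_cat u v : cabsw (u ++ v) = cabsw u ++ cabsw v.
Proof. exact: map_cat. Qed.

Lemma csumcol_cat u v : csumcol (u ++ v) = (csumcol u + csumcol v)%N.
Proof. by rewrite /csumcol map_cat sumn_cat. Qed.

Definition hook_inv (w : seq cint) := sumn [seq invw (cabsw v) | v <- (hook_parse w).2].

Lemma hook_inv_le w : uniq (cabsw w) -> (hook_inv w <= invw (cabsw w))%N.
Proof.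
move/hook_parseP => [def_w _ _].
rewrite /hook_inv [in X in (_ <= X)%N]def_w cabsw_cat invw_cat -addnA.
rewrite addnCA; apply: leq_trans (leq_addr _ _).
elim: (hook_parse w).2 => //= v vs IH.
by rewrite cabsw_cat invw_cat -addnA leq_add2l (leq_trans IH) // leq_addr.
Qed.

Section FactorWeight.
Variables (l : nat) (S : comNzRingType) (t r q : S).

Definition hook_word_weight (v : seq cint) : S :=
  t ^+ (l.+1 * invw (cabsw v) + csumcol v).

Definition factor_weight (w : seq cint) : S :=
  t ^+ (l.+1 * hook_inv w + csumcol w) * r ^+ size (hook_parse w).1
    * q ^+ (invw (cabsw w) - hook_inv w).

Lemma factor_weight_cat w v : uniq (cabsw w) -> colored_hook v ->
  factor_weight (w ++ v) = factor_weight w * hook_word_weight v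
    * q ^+ (\sum_(x <- cabsw w) \sum_(y <- cabsw v) (y < x)).
Proof.
move=> uniq_w hook_v; rewrite /factor_weight /hook_inv hook_parse_rcons //=.
rewrite map_rcons sumn_rcons -/(hook_inv w) cabsw_cat invw_cat csumcol_cat.
have le_inv := hook_inv_le uniq_w; set c := (\sum_(x <- _) _)%N.
(* The truncated subtraction is additive here because lec is at most inv on [w]. *)
have -> : (invw (cabsw w) + invw (cabsw v) + c - (hook_inv w + invw (cabsw v)) =
  invw (cabsw w) - hook_inv w + c)%N by lia.
by rewrite /hook_word_weight !(mulnDr, exprD); ring.
Qed.

Lemma factor_weight_plain w : plain_increasing w -> factor_weight w = r ^+ size w.
Proof.
move=> inc_w; have := hook_parse_flatten inc_w (erefl : all colored_hook [::]).
rewrite cats0 /factor_weight /hook_inv => -> /=; case/andP: inc_w => w0 sorted_w.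
rewrite muln0 invw_sorted // (_ : csumcol w = 0%N) ?mulr1 ?mul1r //.
by rewrite /csumcol; elim: w w0 {sorted_w} => //= x w IH /andP[/eqP -> /IH].
Qed.

End FactorWeight.

Section HookSums.
Variables (n l : nat) (S : comNzRingType) (t r q : S).
Local Notation cletter := (cletter n l).
Implicit Types (A X : {set 'I_n}) (w u v : seq cletter).

Definition plain_word A : seq cletter := [seq (i, ord0) | i <- enum A].

Lemma size_plain_word A : size (plain_word A) = #|A|.
Proof. by rewrite size_map -cardE. Qed.

Lemma word_on_plain A : word_on A (plain_word A).
Proof.
have fstK : unzip1 (plain_word A) = enum A by rewrite /unzip1 -map_comp map_id.
rewrite /word_on fstK enum_uniq; apply/eqP/setP => i.
by rewrite inE mem_enum.
Qed.

Lemma plain_increasing_plain A : plain_increasing (cword_of (plain_word A)).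
Proof.
rewrite /plain_increasing cabsw_cword_of; apply/andP; split.
  by rewrite !all_map; apply/allP.
have -> : unzip1 (plain_word A) = enum A by rewrite /unzip1 -map_comp map_id.
by rewrite sorted_map; have := starts_sorted A; rewrite sorted_map.
Qed.

Lemma plain_word_unique A w :
  word_on A w && plain_increasing (cword_of w) = (w == plain_word A).
Proof.
apply/andP/eqP => [[on_w /andP[w0]]|->]; last first.
  by rewrite word_on_plain plain_increasing_plain.
rewrite cabsw_cword_of sorted_map /plain_word => sorted_w.
have <- : unzip1 w = enum A.
  have lt_tr : transitive (relpre (fun i : 'I_n => (val i).+1) ltn).
    by move=> ? ? ?; apply: ltn_trans.
  apply: (irr_sorted_eq lt_tr) => //; first by move=> i /=; rewrite ltnn.
    by have := starts_sorted A; rewrite sorted_map.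
  move=> i; case/andP: on_w => _ /eqP <-; by rewrite mem_enum inE.
elim: w w0 {on_w sorted_w} => //= -[i c] w IH /andP[/eqP c0 /IH <-].
by congr ((_, _) :: _); apply: val_inj.
Qed.

Definition hook_sum A : S :=
  wsum #|A| (fun w => if word_on A w then factor_weight l t r q (cword_of w) else 0).

Definition single_hook_sum X : S :=
  wsum #|X| (fun v => if word_on X v && colored_hook (cword_of v)
                      then hook_word_weight l t (cword_of v) else 0).

Lemma wsum_word_on_ne A k (F : seq cletter -> S) : k != #|A| ->
  wsum k (fun w => if word_on A w then F w else 0) = 0.
Proof.
move=> ne_k; rewrite -[RHS](wsum0 cletter S k); apply: eq_wsum => w size_w.
by case: ifP => // /size_word_on; rewrite size_w => /eqP; rewrite (negPf ne_k).
Qed.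

(** A word that is not plain is cut before its last hook, at position i, and X is the letter set of
    that hook. For given X only i = |A| - |X| contributes; X is nonempty because i < |A|. *)
Lemma hook_sum_recurrence A :
  hook_sum A = r ^+ #|A| + \sum_(X : {set 'I_n} | (X \subset A) && (X != set0))
    q ^+ crossings (A :\: X) X * single_hook_sum X * hook_sum (A :\: X).
Proof.
pose fw w := factor_weight l t r q (cword_of w).
transitivity (wsum #|A| (fun w => (if w == plain_word A then fw w else 0) +
   \sum_(i < #|A|) if word_on A w && colored_hook (drop i (cword_of w)) then fw w else 0)).
  apply: eq_wsum => w size_w; rewrite -plain_word_unique.
  case: (boolP (word_on A w)) => [on_w|_] /=; last by rewrite add0r big1.
  have := unique_last_hook (word_on_uniq on_w); rewrite {1}/cword_of size_map size_w.
  move=> /(congr1 (GRing.natmul (fw w))); rewrite mulrnDr mulr1n -sumrMnr => Efw; rewrite -[LHS]Efw.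
  congr (_ + _); first by case: plain_increasing.
  by apply: eq_bigr => i _; case: colored_hook.
rewrite wsumD; congr (_ + _).
  rewrite -{1}(size_plain_word A) wsum_pred1 /fw factor_weight_plain.
    by rewrite size_map size_plain_word.
  exact: plain_increasing_plain.
rewrite wsum_sum.
transitivity (\sum_(i < #|A|) \sum_(X : {set 'I_n} | X \subset A)
   wsum i (fun u => if word_on (A :\: X) u then fw u else 0) *
   (wsum (#|A| - i) (fun v => if word_on X v && colored_hook (cword_of v)
                      then hook_word_weight l t (cword_of v) else 0)
    * q ^+ crossings (A :\: X) X)).
  apply: eq_bigr => i _; have le_i := ltnW (ltn_ord i).
  rewrite -{1}(subnKC le_i) wsum_cat.
  transitivity (wsum i (fun u => wsum (#|A| - i) (fun v =>
     \sum_(X : {set 'I_n} | X \subset A) (if word_on (A :\: X) u then fw u else 0) *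
       ((if word_on X v && colored_hook (cword_of v)
         then hook_word_weight l t (cword_of v) else 0) * q ^+ crossings (A :\: X) X)))).
    apply: eq_wsum => u size_u; apply: eq_wsum => v _.
    rewrite -[i : nat]size_u -(size_map (fun z : cletter => ((val z.1).+1, val z.2)) u).
    rewrite {1}/cword_of map_cat drop_size_cat // -/(cword_of u) -/(cword_of v).
    transitivity ((word_on A (u ++ v) && colored_hook (cword_of v))%:R * fw (u ++ v)).
      by case: ifP; rewrite ?mul1r ?mul0r.
    case: (boolP (colored_hook (cword_of v))) => [hook_v|_]; last first.
      by rewrite andbF mul0r big1 // => X _; rewrite andbF mul0r mulr0.
    rewrite andbT word_on_cat natr_sum mulr_suml; apply: eq_bigr => X _; rewrite andbT.
    case: (boolP (word_on (A :\: X) u)) => [on_u|_]; last by rewrite !mul0r.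
    case: (boolP (word_on X v)) => [on_v|_]; last by rewrite !mul0r mulr0.
    rewrite mul1r /fw {1}/cword_of map_cat -/(cword_of u) -/(cword_of v).
    rewrite factor_weight_cat ?(word_on_uniq on_u) //.
    by rewrite (word_on_crossings on_u on_v) mulrA.
  under eq_wsum => u _ do rewrite wsum_sum.
  rewrite wsum_sum; apply: eq_bigr => X _.
  rewrite -wsumMr; apply: eq_wsum => u _.
  by rewrite wsumMl wsumMr.
rewrite exchange_big /= big_mkcondr /=; apply: eq_bigr => X sub_XA.
have cardA : #|A :\: X| = (#|A| - #|X|)%N by rewrite cardsDS.
have le_card := subset_leq_card sub_XA.
rewrite -(cards_eq0 X); case: (posnP #|X|) => [X0|X_gt0].
  rewrite big1 //= => i _; rewrite [X in X * _]wsum_word_on_ne ?mul0r //.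
  by rewrite cardA X0 subn0 ltn_eqF ?ltn_ord.
have lt_i : (#|A| - #|X| < #|A|)%N by lia.
rewrite (bigD1 (Ordinal lt_i)) //= [X in _ + X]big1 ?addr0 => [|i ne_i].
  rewrite /hook_sum cardA /single_hook_sum subKn //.
  by rewrite [in RHS]mulrC [in RHS](mulrC (q ^+ _)).
rewrite [X in X * _]wsum_word_on_ne ?mul0r // cardA.
by apply: contraNN ne_i => /eqP Ei; apply/eqP/val_inj.
Qed.

End HookSums.


(** * Ranks and q-binomial coefficients *)

Lemma set_max_ind n (P : {set 'I_n} -> Prop) :
  P set0 ->
  (forall (A : {set 'I_n}) (b : 'I_n),
    (forall i, i \in A -> (i < b)%N) -> P A -> P (b |: A)) ->
  forall A, P A.
Proof.
move=> P0 PS A; move: {2}#|A| (erefl #|A|) => m; elim: m A => [|m IH] A.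
  by move/eqP; rewrite cards_eq0 => /eqP ->.
move=> cardA; have /card_gt0P[i0 A_i0] : (0 < #|A|)%N by rewrite cardA.
case: (@arg_maxnP _ i0 (mem A) (@nat_of_ord n) A_i0) => b max_A max_b.
have A_b : b \in A := max_A.
rewrite -(setD1K A_b); apply: PS => [i|].
  rewrite !inE => /andP[ne_ib A_i]; rewrite ltn_neqAle ne_ib; exact: max_b.
by apply: IH; move: cardA; rewrite (cardsD1 b) A_b add1n => -[].
Qed.

Lemma max_notin n (A : {set 'I_n}) (b : 'I_n) : (forall i, i \in A -> (i < b)%N) -> b \notin A.
Proof. by move=> lt_b; apply/negP => /lt_b; rewrite ltnn. Qed.

Lemma sum_ranks n (S : nmodType) (f : nat -> S) (A : {set 'I_n}) :
  \sum_(j in A) f (\sum_(i in A) (i < j))%N = \sum_(k < #|A|) f k.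
Proof.
elim/set_max_ind: A => [|A b lt_b IH]; first by rewrite big_set0 cards0 big_ord0.
have A_b := max_notin lt_b; rewrite big_setU1 //= cardsU1 A_b add1n big_ord_recr /=.
rewrite addrC -IH; congr (_ + f _).
  apply: eq_bigr => j A_j; rewrite big_setU1 //= ltnNge ltnW ?lt_b //.
rewrite big_setU1 //= ltnn add0n -sum1_card; apply: eq_bigr => i /lt_b -> //.
Qed.

Section QBinomial.
Variables (n N : nat) (S : comNzRingType) (q : S).
Hypothesis qN : q ^+ N = 0.
Implicit Types A X : {set 'I_n}.
Local Notation P := (geometric_prod N q).

(** The q-binomial coefficient of |A| and m. *)
Definition subset_crossing_sum A m : S :=
  \sum_(X : {set 'I_n} | (X \subset A) && (#|X| == m)) q ^+ crossings (A :\: X) X.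

Lemma big_subsetU1 (F : {set 'I_n} -> S) A b : b \notin A ->
  \sum_(X : {set 'I_n} | X \subset b |: A) F X =
  \sum_(X : {set 'I_n} | X \subset A) F X + \sum_(X : {set 'I_n} | X \subset A) F (b |: X).
Proof.
move=> A_b; rewrite (bigID (fun X => b \in X)) /= addrC; congr (_ + _).
  apply: eq_bigl => X; rewrite -[A in RHS](setU1K A_b) subsetD1.
  by congr (_ && _); rewrite setU1K.
rewrite (reindex_onto (fun X => b |: X) (fun X => X :\ b)) /=; last first.
  by move=> X /andP[_ X_b]; rewrite setD1K.
apply: eq_bigl => X; rewrite setU11 andbT.
apply/andP/idP => [[/subsetP sub_X /eqP XK]|sub_X].
  apply/subsetP => i X_i; have := sub_X i; rewrite !inE X_i orbT => /(_ isT).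
  case/orP => // /eqP Ei; move: X_i; rewrite Ei -XK !inE eqxx //.
have X_b : b \notin X by apply: contra A_b; apply: (subsetP sub_X).
by rewrite setUS // setU1K.
Qed.

(** The q-Pascal rule: the new maximum, left out of X, forms an inversion with each of the m + 1
    elements of X; put into X, it forms none. *)
Lemma subset_crossing_sumS A (b : 'I_n) m : (forall i, i \in A -> (i < b)%N) ->
  subset_crossing_sum (b |: A) m.+1 =
  q ^+ m.+1 * subset_crossing_sum A m.+1 + subset_crossing_sum A m.
Proof.
move=> lt_b; have A_b := max_notin lt_b.
rewrite /subset_crossing_sum !big_mkcondr big_subsetU1 // mulr_sumr.
congr (_ + _); apply: eq_bigr => X sub_XA;
  have X_b : b \notin X by apply: contra A_b; apply: (subsetP sub_XA).
  case: eqP => [cardX|_]; last by rewrite mulr0.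
  have -> : (b |: A) :\: X = b |: (A :\: X).
    apply/setP => i; rewrite !inE; case: eqP => [->|] //=; by rewrite X_b.
  rewrite /crossings big_setU1 ?inE ?negb_and ?A_b ?orbT //= exprD; congr (_ ^+ _ * _).
  rewrite -cardX -sum1_card; apply: eq_bigr => j /(subsetP sub_XA) /lt_b -> //.
rewrite cardsU1 X_b add1n eqSS; case: eqP => // _; congr (_ ^+ _).
have -> : (b |: A) :\: (b |: X) = A :\: X.
  apply/setP => i; rewrite !inE negb_or; case: eqP => [->|] //=; by rewrite (negPf A_b) andbF.
apply: eq_bigr => i; rewrite !inE => /andP[_ A_i]; rewrite big_setU1 //=.
by rewrite ltnNge ltnW ?lt_b.
Qed.

Lemma geometric_prodS m : P m = (1 - q ^+ m.+1) * P m.+1.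
Proof. by rewrite /geometric_prod big_ord_recr /= mulrCA geometricK ?mulr1. Qed.

Lemma subset_crossing_sum_geometric A m : (m <= #|A|)%N ->
  subset_crossing_sum A m * P #|A| = P m * P (#|A| - m).
Proof.
have P0 : P 0 = 1 by rewrite /geometric_prod big_ord0.
have sum0 A' : subset_crossing_sum A' 0 = 1.
  rewrite /subset_crossing_sum (big_pred1 set0) => [|X].
    by rewrite /crossings big1 // => i _; rewrite big_set0.
  by rewrite /= cards_eq0; case: eqP => [->|]; rewrite ?sub0set ?andbF.
elim/set_max_ind: A m => [|A b lt_b IH] [|m] le_m; rewrite ?sum0 ?P0 ?subn0 //.
  by rewrite cards0 in le_m.
have A_b := max_notin lt_b; rewrite subset_crossing_sumS //.
move: le_m; rewrite cardsU1 A_b add1n ltnS subSS => le_m.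
have E : subset_crossing_sum A m.+1 * P #|A| =
    P m.+1 * ((1 - q ^+ (#|A| - m)) * P (#|A| - m)).
  (* For m = |A| the induction hypothesis does not apply, but both sides are 0. *)
  case: (ltnP m #|A|) => [lt_m|ge_m].
    by rewrite IH // -(subnSK lt_m) -geometric_prodS.
  have -> : (#|A| - m = 0)%N by lia.
  rewrite expr0 subrr mul0r mulr0 /subset_crossing_sum big_pred0 ?mul0r // => X.
  apply/negbTE/negP => /andP[/subset_leq_card le_X /eqP cardX]; lia.
have Em := IH m le_m.
have -> : P #|A|.+1 = P #|A| * geometric N q #|A|.+1.
  by rewrite /geometric_prod big_ord_recr.
have -> : (q ^+ m.+1 * subset_crossing_sum A m.+1 + subset_crossing_sum A m) *
    (P #|A| * geometric N q #|A|.+1) =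
  (q ^+ m.+1 * (subset_crossing_sum A m.+1 * P #|A|) + subset_crossing_sum A m * P #|A|)
    * geometric N q #|A|.+1 by ring.
rewrite E Em (geometric_prodS m).
have Eq : q ^+ m.+1 * q ^+ (#|A| - m) = q ^+ #|A|.+1.
  by rewrite -exprD; congr (_ ^+ _); lia.
transitivity (P m.+1 * P (#|A| - m) *
    ((1 - q ^+ m.+1 * q ^+ (#|A| - m)) * geometric N q #|A|.+1)); first by ring.
by rewrite Eq geometricK // mulr1.
Qed.

End QBinomial.

(** * The weight of the colored hooks on a set *)

Section SingleHooks.
Variables (n l : nat) (S : comNzRingType) (t : S).

Lemma word_on_cons (X : {set 'I_n}) (z : cletter n l) u :
  word_on X (z :: u) = (z.1 \in X) && word_on (X :\ z.1) u.
Proof.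
rewrite /word_on /=; apply/andP/andP => [[/andP[z_u uniq_u] /eqP <-]|].
  rewrite !inE eqxx uniq_u; split=> //=; apply/eqP/setP => i; rewrite !inE.
  by case: eqP => //= ->; apply/negbTE.
case=> X_z /andP[uniq_u /eqP Xu].
have memX i : (i \in unzip1 u) = (i != z.1) && (i \in X).
  by have := congr1 (fun W : {set 'I_n} => i \in W) Xu; rewrite !inE.
rewrite memX eqxx uniq_u; split=> //; apply/eqP/setP => i; rewrite !inE memX.
by case: eqP => //= ->.
Qed.

(** Hooks together with the plain word, of weight 1, are the words with an arbitrary first letter
    and an increasing plain rest. A first letter of rank k and color c has weight T^k t^c, which
    gives the product; the plain word accounts for the -1. *)
Lemma single_hook_sumE (X : {set 'I_n}) : X != set0 ->
  single_hook_sum l t X = hook_weight l t #|X|.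
Proof.
move=> X_neq0; pose hw (v : seq (cletter n l)) := hook_word_weight l t (cword_of v).
have hw_plain (A : {set 'I_n}) : hw (plain_word l A) = 1.
  have /andP[w0 sorted_w] := plain_increasing_plain l A.
  rewrite /hw /hook_word_weight invw_sorted // muln0 add0n /csumcol.
  by elim: cword_of w0 {sorted_w} => //= x w IH /andP[/eqP -> /IH].
apply/eqP; rewrite /hook_weight -subr_eq0 opprB addrA subr_eq0 -(hw_plain X).
have [m cardX] : exists m, #|X| = m.+1.
  by exists #|X|.-1; rewrite prednK // card_gt0.
rewrite -[hw _](wsum_pred1 (plain_word l X) hw) size_plain_word /single_hook_sum -wsumD.
rewrite {1}cardX /=; apply/eqP.
transitivity (\sum_(z : cletter n l | z.1 \in X) hw (z :: plain_word l (X :\ z.1))).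
  rewrite [RHS]big_mkcond; apply: eq_bigr => z _ /=.
  transitivity (wsum m (fun u => if (z.1 \in X) && (u == plain_word l (X :\ z.1))
     then hw (z :: u) else 0)).
    apply: eq_wsum => u _; rewrite -!plain_word_unique.
    have := @plain_or_hook ((val z.1).+1, val z.2) (cword_of u).
    rewrite -[_ :: cword_of u]/(cword_of (z :: u)) uniq_cabsw -/(hw _).
    set inc := plain_increasing (cword_of (z :: u)).
    set hook_zu := colored_hook (cword_of (z :: u)).
    case: (boolP (word_on X (z :: u))) => [/[dup] /andP[uniq_zu _]|]; rewrite word_on_cons.
      case/andP=> -> -> /(_ uniq_zu) /=.
      by case: inc; case: hook_zu; case: plain_increasing => //= _; rewrite ?addr0 ?add0r.
    rewrite negb_and => /orP[/negPf ->|/negPf ->] _; rewrite ?andbF addr0 //.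
  case: (boolP (z.1 \in X)) => X_z /=; last exact: wsum0.
  have <- : size (plain_word l (X :\ z.1)) = m.
    by rewrite size_plain_word; move: cardX; rewrite (cardsD1 z.1) X_z add1n => -[].
  exact: wsum_pred1.
transitivity (\sum_(j in X) \sum_(c < l.+1) t ^+ l.+1 ^+ (\sum_(i in X) (i < j)) * t ^+ c).
  rewrite pair_big_dep /=; apply: eq_big => [[j c]|[j c] /= X_j]; rewrite /= ?andbT //.
  rewrite /hw /hook_word_weight -exprM -exprD; congr (_ ^+ (_ * _ + _)).
    have /andP[_ sorted_w] := plain_increasing_plain l (X :\ j).
    rewrite /= invw_cons invw_sorted // addn0 cabsw_cword_of big_map.
    rewrite (word_on_sum _ (word_on_plain l (X :\ j))) [RHS](big_setD1 j) //= ltnn add0n.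
    by apply: eq_bigr.
  have /andP[w0 _] := plain_increasing_plain l (X :\ j).
  rewrite /csumcol /= -[RHS]addn0; congr (_ + _)%N.
  by elim: (cword_of (plain_word l _)) w0 => //= x w IH /andP[/eqP -> /IH].
rewrite -(sum_ranks (fun k => t ^+ l.+1 ^+ k)) /color_sum mulr_sumr.
by apply: eq_bigr => j _; rewrite mulrC mulr_sumr.
Qed.

End SingleHooks.


(** * Comparison of the two recurrences when q is nilpotent *)

Section NilpotentParameter.
Variables (l n N : nat) (S : comNzRingType) (t r q : S).
Hypothesis qN : q ^+ N = 0.
Hypothesis regT : GRing.lreg (1 - t ^+ l.+1).
Local Notation P := (geometric_prod N q).

Lemma geometric_prod_unit m : exists p, p * P m = 1.
Proof.
elim: m => [|m [p Ep]]; first by exists 1; rewrite /geometric_prod big_ord0 mulr1.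
exists (p * (1 - q ^+ m.+1)); rewrite -mulrA -geometric_prodS //.
Qed.

Lemma hook_sum_valid_words B (A : {set 'I_n}) : (#|A| < B)%N ->
  hook_sum l t r q A * P #|A| =
  valid_words_sum l B t r (fun k : 'I_N => q ^+ (N.-1 - k)) #|A|.
Proof.
set Q := valid_words_sum _ _ _ _ _.
have [m] := ubnP #|A|; elim: m A => // m IH A lt_Am lt_AB.
have := valid_words_sum_recurrence r (fun k : 'I_N => q ^+ (N.-1 - k)) regT lt_AB.
rewrite -/Q (eq_bigr (fun i : 'I_#|A|.+1 => hook_weight l t i * P i * Q (#|A| - i)%N)); last first.
  by move=> i _; rewrite complete_sum_geometric // (leq_trans (ltn_ord i)).
(* The term m = 0, with hook weight -1, is moved across to isolate [Q #|A|]. *)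
rewrite complete_sum_geometric // big_ord_recl /= /hook_weight big_ord0 mulr0 sub0r.
rewrite /geometric_prod big_ord0 -/(geometric_prod N q _) subn0 mulr1 mulN1r => /eqP.
rewrite addrC subr_eq addrC -subr_eq opprK addrC => /eqP <-.
rewrite hook_sum_recurrence mulrDl; congr (_ + _).
rewrite mulr_suml.
transitivity (\sum_(i < #|A|) \sum_(X : {set 'I_n} | (X \subset A) && (#|X| == i.+1))
   q ^+ crossings (A :\: X) X * single_hook_sum l t X * hook_sum l t r q (A :\: X) * P #|A|).
  rewrite (exchange_big_dep (fun X : {set 'I_n} => (X \subset A) && (X != set0))) /=; last first.
    by move=> i X _ /andP[-> /eqP cardX]; rewrite -cards_eq0 cardX.
  apply: eq_bigr => X /andP[sub_XA X_neq0].
  have lt_X : (#|X|.-1 < #|A|)%N.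
    by rewrite prednK ?card_gt0 // subset_leq_card.
  rewrite (big_pred1 (Ordinal lt_X)) // => i; rewrite sub_XA /= -val_eqE /=.
  by rewrite -[#|X| in LHS]prednK ?card_gt0 // eqSS eq_sym.
apply: eq_bigr => i _; rewrite -/(hook_weight _ _ _).
(* The inverse [p] of P_(|A| - m) expresses the inner hook sum as [p] times Q, the same for all X of
   size m; the remaining sum over X is a q-binomial coefficient. *)
have [p Ep] := geometric_prod_unit (#|A| - i.+1).
rewrite (eq_bigr (fun X => hook_weight l t i.+1 * (p * Q (#|A| - i.+1)%N) *
  (q ^+ crossings (A :\: X) X * P #|A|))).
  rewrite -mulr_sumr -mulr_suml -/(subset_crossing_sum q A i.+1).
  rewrite (subset_crossing_sum_geometric qN) ?ltn_ord //.
  rewrite /bump add1n -/(geometric_prod N q _).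
  by rewrite -[RHS]mulr1 -[X in _ = _ * X]Ep; ring.
move=> X /andP[sub_XA /eqP cardX].
have cardAX : #|A :\: X| = (#|A| - i.+1)%N by rewrite cardsDS // cardX.
have lt_i := ltn_ord i; have := IH (A :\: X); rewrite cardAX => <-; [|lia|lia].
rewrite single_hook_sumE -?cards_eq0 cardX //; set a := hook_sum _ _ _ _ _.
by rewrite -[LHS]mulr1 -[X in _ * X]Ep; ring.
Qed.

Lemma eulerian_hook_sum :
  eulerian_sum l n t r q = hook_sum l t r q [set: 'I_n].
Proof.
have [p Ep] := geometric_prod_unit n.
rewrite -[LHS]mulr1 -[RHS]mulr1 -Ep mulrCA [RHS]mulrCA; congr (_ * _).
rewrite (eulerian_sum_valid_words _ _ _ qN (ltnSn n)).
by have := @hook_sum_valid_words n.+1 [set: 'I_n]; rewrite cardsT card_ord => ->.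
Qed.

End NilpotentParameter.

(** * Transfer to arbitrary parameters *)

Section Transfer.
Variables (l n : nat).

Definition hook_factorization_sum (S : comNzRingType) (t r q : S) : S :=
  \sum_(s : 'S_n) \sum_(e : {ffun 'I_n -> 'I_l.+1})
    t ^+ cflec n l.+1 (cword s e) * r ^+ cpix n (cword s e)
      * q ^+ (cinv (cword s e) - clec n (cword s e)).

Lemma cword_cword_of (s : 'S_n) (e : {ffun 'I_n -> 'I_l.+1}) :
  cword s e = cword_of [seq (s i, e i) | i <- enum 'I_n].
Proof. by rewrite /cword_of -map_comp. Qed.

Lemma uniq_cword (s : 'S_n) (e : {ffun 'I_n -> 'I_l.+1}) : uniq (cabsw (cword s e)).
Proof.
rewrite cword_cword_of uniq_cabsw /unzip1 -map_comp map_inj_uniq ?enum_uniq //.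
exact: perm_inj.
Qed.

Lemma chf_cword (s : 'S_n) (e : {ffun 'I_n -> 'I_l.+1}) :
  chf n (cword s e) = hook_parse (cword s e).
Proof. by apply: chf_hook_parse; rewrite ?size_cword ?uniq_cword. Qed.

Lemma hook_factorization_sumE (S : comNzRingType) (t r q : S) :
  hook_factorization_sum t r q = hook_sum l t r q [set: 'I_n].
Proof.
rewrite /hook_sum cardsT card_ord -wsum_ffun -big_mkcond /=.
pose h (p : 'S_n * {ffun 'I_n -> 'I_l.+1}) := [ffun i => (p.1 i, p.2 i)].
(* The default permutation concerns only words with a repeated letter, which the condition [word_on]
   excludes. *)
pose h' (v : {ffun 'I_n -> 'I_n * 'I_l.+1}) :=
  (insubd (1%g : 'S_n) [ffun i => (v i).1], [ffun i => (v i).2]).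
rewrite (reindex_onto h h') /=; last first.
  move=> v /andP[uniq_v _].
  have inj_v : injectiveb [ffun i => (v i).1].
    move: uniq_v; rewrite /unzip1 -map_comp /injectiveb /dinjectiveb.
    by rewrite (eq_map (g := [ffun i => (v i).1])) // => i; rewrite ffunE.
  apply/ffunP => i; rewrite ffunE /= ffunE -pvalE -[pval _]/(val _) val_insubd inj_v ffunE.
  by rewrite -surjective_pairing.
have word_h s e : [seq h (s, e) i | i <- enum 'I_n] = [seq (s i, e i) | i <- enum 'I_n].
  by apply: eq_map => i; rewrite ffunE.
rewrite /hook_factorization_sum pair_big /=; apply: eq_big => [[s e]|[s e] _] /=.
  have -> : h' (h (s, e)) = (s, e).
    congr (_, _); last by apply/ffunP => i; rewrite !ffunE.
    apply: val_inj; rewrite val_insubd ifT.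
      by apply/ffunP => i; rewrite !ffunE /= -[pval _]/(val s) [val s]/= pvalE.
    by apply/injectiveP => i i'; rewrite !ffunE /=; apply: perm_inj.
  rewrite eqxx andbT word_h /word_on -uniq_cabsw -cword_cword_of uniq_cword /=.
  apply/esym/eqP/setP => i; rewrite !inE /unzip1 -map_comp; apply/mapP.
  by exists (s^-1 i)%g; rewrite ?mem_enum //= permKV.
by rewrite word_h -cword_cword_of /factor_weight /cflec /cpix /clec /cinv chf_cword.
Qed.

Lemma eulerian_sum_rmorph (S S' : comNzRingType) (f : {rmorphism S -> S'}) (t r q : S) :
  f (eulerian_sum l n t r q) = eulerian_sum l n (f t) (f r) (f q).
Proof.
rewrite rmorph_sum; apply: eq_bigr => s _; rewrite rmorph_sum; apply: eq_bigr => e _.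
by rewrite !rmorphM !rmorphXn.
Qed.

Lemma hook_factorization_sum_rmorph (S S' : comNzRingType) (f : {rmorphism S -> S'})
    (t r q : S) :
  f (hook_factorization_sum t r q) = hook_factorization_sum (f t) (f r) (f q).
Proof.
rewrite rmorph_sum; apply: eq_bigr => s _; rewrite rmorph_sum; apply: eq_bigr => e _.
by rewrite !rmorphM !rmorphXn.
Qed.

Lemma eulerian_hook_factorization (R : fieldType) (t r q : R) :
  eulerian_sum l n t r q = hook_factorization_sum t r q.
Proof.
pose K := {poly R}.
(* The inner indeterminate stands for t, the outer one for q. *)
pose T : {poly K} := 'X%:P; pose rr : {poly K} := r%:P%:P.
pose p1 := eulerian_sum l n T rr 'X; pose p2 := hook_factorization_sum T rr 'X.
have p12 : p1 = p2.
  (* Both polynomials have size below N, so they are determined by their residues modulo q^N. *)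
  pose N := (maxn (size p1) (size p2)).+1; pose h : {poly K} := 'X^N.
  have size_h : size (mk_monic h) = N.+1 by rewrite mk_monic_Xn size_polyXn.
  have E : in_qpoly h p1 = in_qpoly h p2.
    rewrite eulerian_sum_rmorph hook_factorization_sum_rmorph hook_factorization_sumE.
    apply: (@eulerian_hook_sum _ _ N).
      rewrite -rmorphXn; apply: val_inj; rewrite /= mk_monic_Xn /=.
      by rewrite Pdiv.RingMonic.rmodpp ?monicXn.
    have -> : 1 - in_qpoly h T ^+ l.+1 = (1 - 'X ^+ l.+1) *: (1 : {poly %/ h}).
      rewrite -rmorphXn -(rmorph1 (in_qpoly h)) -rmorphB -in_qpolyZ.
      by congr (in_qpoly h _); rewrite -mul_polyC mulr1 polyCB polyC_exp.
    (* 1 - T lies in the coefficient domain R[t] and is nonzero, so it can be cancelled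
       coefficientwise in q. *)
    move=> x y; rewrite -!scalerAl !mul1r => /(congr1 val) /= Exy.
    have c_neq0 : 1 - 'X ^+ l.+1 != 0 :> K.
      apply/eqP => /(congr1 (fun c : K => c`_l.+1)) /eqP.
      by rewrite coefB coef1 coefXn eqxx coef0 sub0r oppr_eq0 oner_eq0.
    apply: val_inj; apply/polyP => i; apply: (mulfI c_neq0).
    by rewrite -!coefZ Exy.
  have [lt1 lt2] : (size p1 < size (mk_monic h) /\ size p2 < size (mk_monic h))%N.
    by rewrite size_h /N !ltnS; split; apply: leqW; rewrite ?leq_maxl ?leq_maxr.
  by rewrite -(in_qpoly_small lt1) -(in_qpoly_small lt2) E.
have := congr1 (horner_eval t \o horner_eval q%:P) p12.
rewrite /p1 /p2 eulerian_sum_rmorph hook_factorization_sum_rmorph /=.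
by rewrite /horner_eval /T /rr !hornerE.
Qed.

End Transfer.

Theorem theorem4p21 (l n : nat) (R : fieldType) (t r q : R) :
  (0 < l)%N -> (1 <= n)%N -> q != 0 ->
  \sum_(s : 'S_n) \sum_(e : {ffun 'I_n -> 'I_l})
     t ^+ cfexc l (cword s e) * r ^+ cfix (cword s e)
       * q ^ ((cmaj (cword s e))%:Z - (cexc (cword s e))%:Z)
  = \sum_(s : 'S_n) \sum_(e : {ffun 'I_n -> 'I_l})
     t ^+ cflec n l (cword s e) * r ^+ cpix n (cword s e)
       * q ^ ((cinv (cword s e))%:Z - (clec n (cword s e))%:Z).
Proof.
case: l => // l _ _ _.
transitivity (eulerian_sum l n t r q).
  apply: eq_bigr => s _; apply: eq_bigr => e _; congr (_ * _).
  (* By [cmaj_cword], exc is at most maj, so the integer exponent is the natural one. *)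
  by rewrite subzn // cmaj_cword leq_addr.
rewrite eulerian_hook_factorization.
apply: eq_bigr => s _; apply: eq_bigr => e _; congr (_ * _).
by rewrite subzn // /clec chf_cword hook_inv_le // uniq_cword.
Qed.
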